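(* Let $(M^4,g_0)$ be a closed connected four-dimensional Riemannian manifold whose Weyl tensor vanishes nowhere, let $a,c\in C^\infty(M)$ with $a>0$ on $M$, put $Lv=-\operatorname{div}(a\nabla v)+c\,v$, and assume that the first eigenvalue $\lambda_1$ of $L$ satisfies $\lambda_1\ge0$. Suppose that $u_1,u_2\in C^2(M)$, with $u_1>0$ and $u_2>0$ in $M$, are both solutions $v$ of the equation $$Lv=\hat{\mathcal D}\left(\int_Mv^{-4}\,dV\right)^{-\frac32}v^{-5}\quad\text{in } M.$$ Then there exists $\beta\in\mathbb R$, $\beta>0$, such that $u_1=\beta u_2$ in $M$.
   Context: All geometric quantities ($\nabla$, $\operatorname{div}$, norms, $dV$) refer to $g_0$. The first eigenvalue is $$\lambda_1=\inf_{u\in H^1(M),\,u\not\equiv0}\frac{\int_M(a|\nabla u|^2+c\,u^2)\,dV}{\int_Mu^2\,dV}.$$ Set $$\mathfrak D(u)=\left(\int_Mu^{-4}\,dV\right)^{\frac12}\int_M(a|\nabla u|^2+c\,u^2)\,dV,\qquad \hat{\mathcal D}=\inf_{0<u\in C^\infty(M)}\mathfrak D(u).$$ *)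

(* Defs.v *)
(* Riemannian geometry of 4-manifolds in local coordinates, over MathComp-Analysis. *)
From HB Require Import structures.
From mathcomp Require Import all_boot all_order all_algebra.
From mathcomp Require Import all_classical all_reals all_analysis.

Set Implicit Arguments.
Unset Strict Implicit.
Unset Printing Implicit Defensive.

Import Order.TTheory GRing.Theory Num.Theory.
Import numFieldNormedType.Exports.

Local Open Scope classical_set_scope.
Local Open Scope ring_scope.

Section Euclidean.
Context {R : realType}.
Implicit Types (O : set 'rV[R]_4) (f : 'rV[R]_4 -> R).

Definition pder (k : 'I_4) f (x : 'rV[R]_4) : R := 'D_(delta_mx 0 k) f x.

Fixpoint Ck_on (m : nat) O f : Prop :=
  (forall x, O x -> {for x, continuous f}) /\
  (if m is m'.+1 then
     forall k, (forall x, O x -> derivable f x (delta_mx 0 k)) /\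
               Ck_on m' O (pder k f)
   else True).

Definition smooth_on O f : Prop := forall m, Ck_on m O f.

End Euclidean.

(* A smooth structure is presented by an atlas, not necessarily maximal. Charts
   are total functions; only their values on [dom i] and on [img i] matter.
   [chart_at] selects a chart around each point; as the measurable types of the
   library are pointed, the underlying space is a nonempty topological space. *)
Record manifold4 (R : realType) (M : ptopologicalType) := Manifold4 {
  chart : Type ;
  dom : chart -> set M ;
  coords : chart -> M -> 'rV[R]_4 ;
  param : chart -> 'rV[R]_4 -> M ;
  img := fun i => coords i @` dom i ;
  chart_at : M -> chart ;
  hausdorffM : hausdorff_space M ;
  second_countableM : @second_countable M ;
  dom_chart_at : forall p, dom (chart_at p) p ;
  dom_open : forall i, open (dom i) ;
  img_open : forall i, open (img i) ;
  coordsK : forall i p, dom i p -> param i (coords i p) = p ;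
  coords_cont : forall i p, dom i p -> {for p, continuous (coords i)} ;
  param_cont : forall i x, img i x -> {for x, continuous (param i)} ;
  transition_smooth : forall i j (k : 'I_4),
    smooth_on (coords i @` (dom i `&` dom j))
              (fun x => coords j (param i x) 0 k) }.

Section Manifold.
Context {R : realType} {M : ptopologicalType} (S : manifold4 R M).

Definition transition (i j : chart S) : 'rV[R]_4 -> 'rV[R]_4 :=
  coords j \o param i.

Definition Ck (m : nat) (u : M -> R) : Prop :=
  forall i : chart S, Ck_on m (img i) (u \o param i).

Definition smooth (u : M -> R) : Prop :=
  forall i : chart S, smooth_on (img i) (u \o param i).

(* Tensors are given by their components in every chart, as functions of the
   coordinates. With row vectors, ['d f x v = v *m 'J f x]. *)
Definition vector_components := chart S -> 'rV[R]_4 -> 'rV[R]_4.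

Definition vector_field (X : vector_components) : Prop :=
  forall i j p, dom i p -> dom j p ->
    X j (coords j p) = X i (coords i p) *m 'J (transition i j) (coords i p).

Record riemannian_metric := RiemannianMetric {
  gmx : chart S -> 'rV[R]_4 -> 'M[R]_4 ;
  gmx_smooth : forall i (k l : 'I_4), smooth_on (img i) (fun x => gmx i x k l) ;
  gmx_sym : forall i x, img i x -> (gmx i x)^T = gmx i x ;
  gmx_pos : forall i x, img i x -> forall v : 'rV[R]_4, v != 0 ->
    0 < (v *m gmx i x *m v^T) 0 0 ;
  gmx_compat : forall i j p, dom i p -> dom j p ->
    gmx i (coords i p) =
      'J (transition i j) (coords i p) *m gmx j (coords j p)
        *m ('J (transition i j) (coords i p))^T }.

End Manifold.

Section Curvature.
Context {R : realType} (g : 'rV[R]_4 -> 'M[R]_4).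
Implicit Types (i j k l m : 'I_4) (x : 'rV[R]_4).

(* Gamma^k_{ij} *)
Definition christoffel k i j x : R :=
  2^-1 * \sum_l invmx (g x) k l *
    (pder i (fun y => g y j l) x + pder j (fun y => g y i l) x
     - pder l (fun y => g y i j) x).

(* R^l_{kij}, where R(d_i, d_j) d_k = R^l_{kij} d_l *)
Definition riemann_up l k i j x : R :=
  pder i (christoffel l j k) x - pder j (christoffel l i k) x
  + \sum_m (christoffel l i m x * christoffel m j k x
            - christoffel l j m x * christoffel m i k x).

(* R_{lkij} = g(R(d_i, d_j) d_k, d_l), so that R_{ijij} > 0 on round spheres *)
Definition riemann l k i j x : R := \sum_m g x l m * riemann_up m k i j x.

Definition ricci k j x : R := \sum_i riemann_up i k i j x.

Definition scalar_curvature x : R :=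
  \sum_k \sum_j invmx (g x) k j * ricci k j x.

(* The coefficients 1/2 and 1/6 are 1/(n-2) and 1/((n-1)(n-2)) for n = 4. *)
Definition weyl l k i j x : R :=
  riemann l k i j x
  - 2^-1 * (g x l i * ricci k j x - g x l j * ricci k i x
            + g x k j * ricci l i x - g x k i * ricci l j x)
  + 6^-1 * scalar_curvature x * (g x l i * g x k j - g x l j * g x k i).

End Curvature.

Section Operators.
Context {R : realType} {M : ptopologicalType} (S : manifold4 R M)
        (g : riemannian_metric S).

Definition weyl_nowhere_zero : Prop :=
  forall (i : chart S) p, dom i p ->
    exists l k a b : 'I_4, weyl (gmx g i) l k a b (coords i p) != 0.

Definition vol_density (i : chart S) (x : 'rV[R]_4) : R :=
  Num.sqrt (\det (gmx g i x)).

Definition grad (u : M -> R) : vector_components S := fun i x =>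
  (\row_k pder k (u \o param i) x) *m invmx (gmx g i x).

Definition divergence (X : vector_components S) (i : chart S) (x : 'rV[R]_4) : R :=
  (vol_density i x)^-1 *
  \sum_k pder k (fun y => vol_density i y * X i y 0 k) x.

(* Value at [x] of L v = - div (a grad v) + c v, expressed in the chart [i]. *)
Definition Lop (a c v : M -> R) (i : chart S) (x : 'rV[R]_4) : R :=
  - divergence (fun j y => a (param j y) *: grad v j y) i x
  + c (param i x) * v (param i x).

(* |X|^2 = g(X, X); for a vector field the choice of the chart is immaterial by
   [gmx_compat]. *)
Definition normsq (X : vector_components S) (p : M) : R :=
  let i := chart_at S p in
  let x := coords i p in
  (X i x *m gmx g i x *m (X i x)^T) 0 0.

End Operators.

Definition borel (M : ptopologicalType) := g_sigma_algebraType (@open M).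

Section Volume.
Context {R : realType} {M : ptopologicalType} (S : manifold4 R M)
        (g : riemannian_metric S).

Definition leb4 : {measure set (measurableTypeR R * measurableTypeR R *
    measurableTypeR R * measurableTypeR R) -> \bar R} :=
  ((@lebesgue_measure R \x @lebesgue_measure R) \x @lebesgue_measure R
    \x @lebesgue_measure R)%E.

Definition rv4 (z : R * R * R * R) : 'rV[R]_4 :=
  \row_k [:: z.1.1.1; z.1.1.2; z.1.2; z.2]`_k.

(* [mu] is dV: the Borel measure equal to sqrt(det g) dx in every chart. As the
   charts cover a second countable space this determines [mu]. *)
Definition is_volume_measure (mu : {measure set (borel M) -> \bar R}) : Prop :=
  forall (i : chart S) (A : set (borel M)), measurable A -> A `<=` dom i ->
    mu A = (\int[leb4]_(z in rv4 @^-1` (coords i @` A))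
              (vol_density g i (rv4 z))%:E)%E.

End Volume.

Section Functionals.
Context {R : realType} {M : ptopologicalType} (S : manifold4 R M)
        (g : riemannian_metric S) (mu : {measure set (borel M) -> \bar R}).

(* H^1(M) is the completion of C^oo(M) for the norm
   (int u^2 + |grad u|^2)^(1/2), realized inside L^2: [in_H1 u X] says that
   [u] belongs to H^1(M) and that [X] is its gradient. *)
Definition in_H1 (u : M -> R) (X : vector_components S) : Prop :=
  [/\ measurable_fun setT (u : borel M -> R),
      vector_field X,
      forall (i : chart S) (k : 'I_4),
        measurable_fun (dom i : set (borel M))
          (fun p : borel M => X i (coords i p) 0 k) &
      exists w : nat -> M -> R, (forall m, smooth S (w m)) /\
        (fun m => \int[mu]_p ((w m p - u p) ^+ 2
           + normsq g (fun i x => grad g (w m) i x - X i x) p)%:E)%E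
          @ \oo --> 0%E].

Definition energy (a c u : M -> R) (X : vector_components S) : R :=
  \int[mu]_p (a p * normsq g X p + c p * u p ^+ 2).

Definition lambda1 (a c : M -> R) : \bar R :=
  ereal_inf [set q | exists u X,
    [/\ in_H1 u X, ~ {ae mu, forall p, u p = 0} &
        q = (energy a c u X / \int[mu]_p (u p ^+ 2))%:E]].

Definition Dfun (a c u : M -> R) : R :=
  Num.sqrt (\int[mu]_p (u p ^- 4)) * energy a c u (grad g u).

Definition Dhat (a c : M -> R) : \bar R :=
  ereal_inf [set q | exists u,
    [/\ smooth S u, forall p, 0 < u p & q = (Dfun a c u)%:E]].

(* L v = Dhat (int v^-4)^(-3/2) v^-5 on M, read in every chart. [Dhat] is never
   +oo on a compact manifold, and is a nonnegative real when [lambda1] is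
   nonnegative, so that [fine] then only casts it to [R]. *)
Definition is_solution (a c v : M -> R) : Prop :=
  forall (i : chart S) (p : M), dom i p ->
    Lop g a c v i (coords i p) =
      fine (Dhat a c) * (\int[mu]_q (v q ^- 4)) `^ (- (3 / 2)) * v p ^- 5.

End Functionals.

(* Main.v *)
Require Import Defs.
From HB Require Import structures.
From mathcomp Require Import all_boot all_order all_algebra.
From mathcomp Require Import all_classical all_reals all_analysis.
From mathcomp Require Import measurable_realfun.
From mathcomp Require Import ring lra.
Set Implicit Arguments.
Unset Strict Implicit.
Unset Printing Implicit Defensive.
Import Order.TTheory GRing.Theory Num.Theory.
Import numFieldNormedType.Exports.
Local Open Scope classical_set_scope.
Local Open Scope ring_scope.

(** The theorem is a comparison principle. Put
      k_j = Dhat * (int u_j^-4)^(-3/2),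
    so that L u_j = k_j u_j^-5 for j = 1, 2, and let m = min (u_1 / u_2) and
    m' = min (u_2 / u_1), both positive as M is compact.

    The function u_1 - m u_2 is nonnegative and vanishes at some p. There the
    zeroth and first order terms of L (u_1 - m u_2) vanish and the second
    order ones have a sign, so L u_1 <= m L u_2 at p ([Lop_at_contact]), which
    reads k_1 <= m^6 k_2 ([contact_inequality]). Exchanging the two functions
    gives k_2 <= m'^6 k_1. Moreover m m' <= 1, because
    u_1 >= m u_2 >= m m' u_1.

    Testing the Rayleigh quotient on smooth positive functions shows that
    lambda_1 >= 0 forces Dhat >= 0 ([Dhat_ge0]), hence k_1, k_2 >= 0. If
    k_1 > 0, then k_1 <= (m m')^6 k_1 yields m m' = 1, and then
    m u_2 <= u_1 <= u_2 / m' = m u_2.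

    Otherwise k_1 = k_2 = 0, so that u_1 and u_2 both solve the linear equation
    L u = 0. Now u_1 - m u_2 is a nonnegative solution with a zero, and Hopf's
    strong minimum principle ([strong_minimum_principle]) makes its zero set
    open; being closed as well, it is the whole connected manifold
    ([contact_everywhere]).

    Apart from the sign of Dhat, everything is thus pointwise, in charts. In a
    chart, -L times the volume density is an operator
      Q f = sum_k d_k (sum_l B_kl d_l f) - C f
    with B symmetric, positive definite and C^1 ([chart_elliptic]). The
    analysis rests on three facts on R^4: C^1 functions are differentiable
    ([C1_differentiable]), the Hessian at a minimum is positive semidefinite
    ([C2_local_min]), and the trace of the product of a positive definite and a
    positive semidefinite matrix is nonnegative ([posdef_psd_trace_ge0]). *)

(** * Calculus of C^m functions on open sets of R^4 *)

Section CkCalculus.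
Context {R : realType}.
Implicit Types (O : set 'rV[R]_4) (f g : 'rV[R]_4 -> R) (m : nat) (k : 'I_4).

Lemma open_near O x : open O -> O x -> \forall y \near x, O y.
Proof. by move=> oO Ox; apply: open_nbhs_nbhs. Qed.

Lemma near_eq_continuous (T U : topologicalType) (f g : T -> U) x :
  {near x, f =1 g} -> {for x, continuous f} -> {for x, continuous g}.
Proof.
move=> fg cf; have e : f x = g x := nbhs_singleton fg.
change (g @ x --> g x); rewrite -e; apply: cvg_trans cf; apply: near_eq_cvg.
by apply: filterS fg => y ->.
Qed.

(** As [O] is open, the derivatives on [O] only depend on the values on [O]. *)
Lemma Ck_on_ext m O f g : open O -> (forall x, O x -> f x = g x) ->
  Ck_on m O f -> Ck_on m O g.
Proof.
move=> oO; elim: m f g => [|m IH] f g fg [cf df].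
  split => // x Ox; apply: near_eq_continuous (cf _ Ox).
  by apply: filterS (open_near oO Ox).
have nfg x : O x -> {near x, f =1 g}.
  by move=> Ox; apply: filterS (open_near oO Ox).
split=> [x Ox|k]; first exact: near_eq_continuous (nfg _ Ox) (cf _ Ox).
split=> [x Ox|]; first exact: near_eq_derivable (nfg _ Ox) ((df k).1 _ Ox).
apply: IH (df k).2 => x Ox; exact: near_eq_derive (nfg _ Ox).
Qed.

Lemma Ck_onS m O f : Ck_on m.+1 O f -> Ck_on m O f.
Proof.
elim: m f => [|m IH] f [cf df]; first by split.
by split=> // k; split; [exact: (df k).1|apply: IH; exact: (df k).2].
Qed.

Lemma Ck_on_continuous m O f x : Ck_on m O f -> O x -> {for x, continuous f}.
Proof. by case: m => [|m] [cf _]; apply: cf. Qed.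

Lemma Ck_on_derivable m O f x k :
  Ck_on m.+1 O f -> O x -> derivable f x (delta_mx 0 k).
Proof. by move=> [_ /(_ k)[df _]]; apply: df. Qed.

Lemma Ck_on_pder m O f k : Ck_on m.+1 O f -> Ck_on m O (pder k f).
Proof. by move=> [_ /(_ k)[_ df]]. Qed.

Lemma Ck_on_cst m O (a : R) : open O -> Ck_on m O (fun=> a).
Proof.
move=> oO; elim: m a => [|m IH] a; split=> //; try by move=> x _; apply: cst_continuous.
move=> k; split=> [x _|]; first exact: derivable_cst.
by apply: Ck_on_ext (IH 0) => // x _; rewrite /pder derive_cst.
Qed.

Lemma Ck_on_coord m O k : open O -> Ck_on m O (fun x => x 0 k).
Proof.
move=> oO; have der x v : 'D_v (fun y : 'rV[R]_4 => y 0 k) x = v 0 k.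
  have dx : derivable (id : 'rV[R]_4 -> 'rV[R]_4) x v by exact: derivable_id.
  by have := derive_mx dx => /(congr1 (fun A : 'rV_4 => A 0 k)); rewrite derive_id mxE.
case: m => [|m]; split=> //; try by move=> x _; exact: coord_continuous.
move=> l; split=> [x _|].
  apply: diff_derivable; exact: differentiable_coord.
by apply: Ck_on_ext (Ck_on_cst m ((delta_mx 0 l : 'rV[R]_4) 0 k) oO) => // x _;
   rewrite /pder der.
Qed.

Lemma Ck_onD m O f g : open O -> Ck_on m O f -> Ck_on m O g ->
  Ck_on m O (fun x => f x + g x).
Proof.
move=> oO; elim: m f g => [|m IH] f g cf cg.
  by split=> // x Ox; exact: (cvgD (Ck_on_continuous cf Ox) (Ck_on_continuous cg Ox)).
split=> [x Ox|k].
  by exact: (cvgD (Ck_on_continuous cf Ox) (Ck_on_continuous cg Ox)).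
split=> [x Ox|].
  have d := derivableD (Ck_on_derivable (k:=k) cf Ox) (Ck_on_derivable (k:=k) cg Ox).
  exact: d.
apply: Ck_on_ext (IH _ _ (Ck_on_pder k cf) (Ck_on_pder k cg)) => // x Ox.
exact/esym/(deriveD (Ck_on_derivable (k:=k) cf Ox) (Ck_on_derivable (k:=k) cg Ox)).
Qed.

Lemma Ck_onM m O f g : open O -> Ck_on m O f -> Ck_on m O g ->
  Ck_on m O (fun x => f x * g x).
Proof.
move=> oO; elim: m f g => [|m IH] f g cf cg.
  by split=> // x Ox; exact: (cvgM (Ck_on_continuous cf Ox) (Ck_on_continuous cg Ox)).
split=> [x Ox|k].
  by exact: (cvgM (Ck_on_continuous cf Ox) (Ck_on_continuous cg Ox)).
split=> [x Ox|].
  have d := derivableM (Ck_on_derivable (k:=k) cf Ox) (Ck_on_derivable (k:=k) cg Ox).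
  exact: d.
apply: Ck_on_ext (Ck_onD oO (IH _ _ (Ck_onS cf) (Ck_on_pder k cg))
  (IH _ _ (Ck_onS cg) (Ck_on_pder k cf))) => // x Ox.
exact/esym/(deriveM (Ck_on_derivable (k:=k) cf Ox) (Ck_on_derivable (k:=k) cg Ox)).
Qed.

(** By induction on [m], from (1/f)' = - (1/f) (1/f) f'. *)
Lemma Ck_onV m O f : open O -> (forall x, O x -> f x != 0) -> Ck_on m O f ->
  Ck_on m O (fun x => (f x)^-1).
Proof.
move=> oO f0; elim: m => [|m IH] cf.
  by split=> // x Ox; exact: (cvgV (f0 _ Ox) (Ck_on_continuous cf Ox)).
split=> [x Ox|k].
  by exact: (cvgV (f0 _ Ox) (Ck_on_continuous cf Ox)).
split=> [x Ox|].
  by apply: derivableV; [exact: f0|apply: Ck_on_derivable cf Ox].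
have cV := IH (Ck_onS cf).
apply: Ck_on_ext (Ck_onM oO (Ck_onM oO (Ck_on_cst m (-1) oO) (Ck_onM oO cV cV))
   (Ck_on_pder k cf)) => // x Ox.
rewrite /pder [RHS]deriveV ?f0//; last exact: Ck_on_derivable cf Ox.
by rewrite -invfM -expr2 mulN1r.
Qed.

(** Restricting to a line gives access to the theorems on functions of one
    variable, such as the chain rule. *)
Lemma derive_line (f : 'rV[R]_4 -> R) (x v : 'rV[R]_4) :
  'D_v f x = derive1 (fun h : R => f (h *: v + x)) 0.
Proof.
rewrite /derive1 /derive.
suff -> : (fun h : R => h^-1 *: ((f \o shift x) (h *: v) - f x)) =
    (fun h : R => h^-1 *: (f ((h + 0) *: v + x) - f (0 *: v + x))) by [].
by rewrite funeqE => h /=; rewrite addr0 scale0r add0r.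
Qed.

Lemma is_derive_comp (f : 'rV[R]_4 -> R) (phi : R -> R) x v (d : R) :
  derivable f x v -> is_derive (f x) 1 phi d ->
  is_derive x v (fun y => phi (f y)) (d * 'D_v f x).
Proof.
move=> /derivable1P df dphi; pose l (h : R) : R := f (h *: v + x).
have e0 : l 0 = f x by rewrite /l scale0r add0r.
rewrite -e0 in dphi; have dp : derivable phi (l 0) 1 by case: dphi.
have df' : derivable l 0 1 := df.
split; last first.
  rewrite !derive_line (derive1_comp df' dp) derive1E.
  by rewrite (@derive_val _ _ _ _ _ _ _ dphi).
apply/derivable1P; apply/derivable1_diffP.
have /derivable1_diffP d1 := df'; have /derivable1_diffP d2 := dp.
exact: (differentiable_comp d1 d2).
Qed.

(** By induction on [m], from (sqrt f)' = f' / (2 sqrt f). *)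
Lemma Ck_on_sqrt m O f : open O -> (forall x, O x -> 0 < f x) -> Ck_on m O f ->
  Ck_on m O (fun x => Num.sqrt (f x)).
Proof.
move=> oO f0.
have cS n : Ck_on n O f -> forall x, O x ->
    {for x, continuous (fun x => Num.sqrt (f x))}.
  move=> cf x Ox; apply: (@continuous_comp _ _ _ f Num.sqrt).
    exact: Ck_on_continuous cf Ox.
  exact: sqrt_continuous.
have dS n x k : Ck_on n.+1 O f -> O x -> is_derive x (delta_mx 0 k)
    (fun x => Num.sqrt (f x)) ((2 * Num.sqrt (f x))^-1 * pder k f x).
  move=> cf Ox; apply: is_derive_comp; first exact: Ck_on_derivable cf Ox.
  by apply: is_derive1_sqrt; exact: f0.
elim: m => [|m IH] cf; first by split=> // x Ox; exact: cS cf x Ox.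
split=> [x Ox|k]; first exact: cS cf x Ox.
split=> [x Ox|]; first by have [] := dS _ _ k cf Ox.
have s0 x : O x -> 2 * Num.sqrt (f x) != 0.
  by move=> Ox; rewrite mulf_neq0// gt_eqF// sqrtr_gt0 f0.
have c2 := Ck_onV oO s0 (Ck_onM oO (Ck_on_cst m 2 oO) (IH (Ck_onS cf))).
apply: Ck_on_ext (Ck_onM oO c2 (Ck_on_pder k cf)) => // x Ox.
have [_ e] := dS _ _ k cf Ox; exact/esym/e.
Qed.

Lemma Ck_on_sum m O (I : Type) (r : seq I) (P : pred I) (F : I -> 'rV[R]_4 -> R) :
  open O -> (forall i, Ck_on m O (F i)) ->
  Ck_on m O (fun x => \sum_(i <- r | P i) F i x).
Proof.
move=> oO cF; elim: r => [|i r IH].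
  by apply: Ck_on_ext (Ck_on_cst m 0 oO) => // x _; rewrite big_nil.
case Pi: (P i).
  by apply: Ck_on_ext (Ck_onD oO (cF i) IH) => // x _; rewrite big_cons Pi.
by apply: Ck_on_ext IH => // x _; rewrite big_cons Pi.
Qed.

Lemma Ck_on_prod m O (I : Type) (r : seq I) (P : pred I) (F : I -> 'rV[R]_4 -> R) :
  open O -> (forall i, Ck_on m O (F i)) ->
  Ck_on m O (fun x => \prod_(i <- r | P i) F i x).
Proof.
move=> oO cF; elim: r => [|i r IH].
  by apply: Ck_on_ext (Ck_on_cst m 1 oO) => // x _; rewrite big_nil.
case Pi: (P i).
  by apply: Ck_on_ext (Ck_onM oO (cF i) IH) => // x _; rewrite big_cons Pi.
by apply: Ck_on_ext IH => // x _; rewrite big_cons Pi.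
Qed.

Lemma Ck_on_det m O n (A : 'rV[R]_4 -> 'M[R]_n) :
  open O -> (forall i j, Ck_on m O (fun x => A x i j)) ->
  Ck_on m O (fun x => \det (A x)).
Proof.
move=> oO cA; apply: Ck_on_sum => // s; apply: Ck_onM => //.
  exact: Ck_on_cst.
by apply: Ck_on_prod.
Qed.

(** Cramer's formula: the entries of the inverse are cofactors divided by the
    determinant. *)
Lemma Ck_on_invmx m O n (A : 'rV[R]_4 -> 'M[R]_n) (i j : 'I_n) : open O ->
  (forall x, O x -> A x \in unitmx) -> (forall i j, Ck_on m O (fun x => A x i j)) ->
  Ck_on m O (fun x => invmx (A x) i j).
Proof.
move=> oO uA cA.
have cdet := Ck_on_det oO cA.
have cV : Ck_on m O (fun x => (\det (A x))^-1).
  by apply: Ck_onV cdet => // x Ox; rewrite -unitfE; exact: uA.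
have ccof : Ck_on m O (fun x => cofactor (A x) j i).
  apply: Ck_onM => //; first exact: Ck_on_cst.
  apply: Ck_on_det => // k l.
  by apply: Ck_on_ext (cA (lift j k) (lift i l)) => // x _; rewrite !mxE.
by apply: Ck_on_ext (Ck_onM oO cV ccof) => // x Ox; rewrite /invmx uA// !mxE.
Qed.

End CkCalculus.

(** * Differentiability of C^1 functions *)

Section Differentiability.
Context {R : realType}.
Implicit Types (O : set 'rV[R]_4) (f : 'rV[R]_4 -> R) (x v y : 'rV[R]_4).

Lemma is_derive_line f y v (s : R) : derivable f (s *: v + y) v ->
  is_derive s 1 (fun h : R => f (h *: v + y)) ('D_v f (s *: v + y)).
Proof.
have E : (fun h : R => h^-1 *: ((f \o shift (s *: v + y)) (h *: v) -
      f (s *: v + y))) =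
    (fun h : R => h^-1 *: (((fun h : R => f (h *: v + y)) \o shift s) (h *: 1)
      - f (s *: v + y))).
  by rewrite funeqE => h /=; rewrite scaler1 scalerDl addrA.
by move=> df; split; rewrite /derivable/= /derive -E.
Qed.

Lemma MVT_line f y v (t : R) :
  (forall s : R, `|s| <= `|t| -> derivable f (s *: v + y) v) ->
  exists2 s : R, `|s| <= `|t| & f (t *: v + y) - f y = t * 'D_v f (s *: v + y).
Proof.
move=> df; pose g h := f (h *: v + y).
have g0 : g 0 = f y by rewrite /g scale0r add0r.
have dg (s : R) : `|s| <= `|t| -> is_derive s 1 g ('D_v f (s *: v + y)).
  by move=> /df; exact: is_derive_line.
have cg (s : R) : `|s| <= `|t| -> {for s, continuous g}.
  by move=> /dg [/derivable1_diffP d _]; exact: differentiable_continuous.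
have [t0|t0|->] := ltgtP t 0; last 1 first.
- by exists 0; rewrite ?normr0// scale0r add0r subrr mul0r.
- have le (s : R) : s \in `[t, 0] -> `|s| <= `|t|.
    by rewrite in_itv/= => /andP[? s0]; rewrite !ler0_norm// ?lerN2// ltW.
  have [||c cI e] := @MVT _ g (fun s => 'D_v f (s *: v + y)) t 0 t0.
  + move=> s; rewrite in_itv/= => /andP[a b]; apply: dg; apply: le.
    by rewrite in_itv/= !ltW.
  + apply: continuous_in_subspaceT => s; rewrite inE/= => /le; exact: cg.
  + exists c; first by apply: le; apply: subset_itv_oo_cc.
    by rewrite -g0 -[LHS]opprB -/(g t) e sub0r mulrN opprK mulrC.
- have le (s : R) : s \in `[0, t] -> `|s| <= `|t|.
    by rewrite in_itv/= => /andP[? s0]; rewrite !ger0_norm// ltW.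
  have [||c cI e] := @MVT _ g (fun s => 'D_v f (s *: v + y)) 0 t t0.
  + move=> s; rewrite in_itv/= => /andP[a b]; apply: dg; apply: le.
    by rewrite in_itv/= !ltW.
  + apply: continuous_in_subspaceT => s; rewrite inE/= => /le; exact: cg.
  + exists c; first by apply: le; apply: subset_itv_oo_cc.
    by rewrite -g0 -/(g t) e subr0 mulrC.
Qed.

Lemma coord_le_norm x (k : 'I_4) : `|x 0 k| <= `|x|.
Proof.
rewrite [leRHS]/Num.Def.normr/= mx_normrE.
by apply: le_trans (le_bigmax _ _ (0, k)).
Qed.

Lemma norm_le_coord x (r : R) : 0 <= r -> (forall k, `|x 0 k| <= r) -> `|x| <= r.
Proof.
move=> r0 xr; rewrite [leLHS]/Num.Def.normr/= mx_normrE bigmax_le//= => -[i k] _.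
by rewrite ord1; exact: xr.
Qed.

Lemma ball_norm x (r : R) y : ball x r y <-> `|x - y| < r.
Proof. by rewrite -ball_normE. Qed.

(** Go from [x] to [x + h] along four edges parallel to the axes. The mean value
    theorem evaluates the increment of [f] along each edge as a partial
    derivative at a point close to [x], which by continuity differs little from
    the partial derivative at [x]. *)
Lemma C1_differentiable O f x : open O -> O x -> Ck_on 1 O f ->
  differentiable f x.
Proof.
move=> oO Ox cf; pose df (h : 'rV[R]_4) := \sum_k h 0 k * pder k f x.
have df_lin : linear df.
  move=> a u w; rewrite /df scaler_sumr -big_split/=; apply: eq_bigr => k _.
  by rewrite !mxE mulrDl -mulrA.
pose dfM := GRing.isLinear.Build _ _ _ _ _ df_lin.
pose dfL : {linear _ -> _} := HB.pack df dfM.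
have df_cont : continuous dfL.
  move=> y; have c0 : Ck_on 0 [set: 'rV[R]_4] df.
    apply: Ck_on_sum => [|k]; first exact: openT.
    apply: Ck_onM; [exact: openT|apply: Ck_on_coord; exact: openT|].
    by apply: Ck_on_cst; exact: openT.
  exact: Ck_on_continuous c0 I.
suff key : forall e : R, 0 < e -> \forall h \near (0 : 'rV[R]_4),
    `|f (h + x) - (f x + df h)| <= e * `|h|.
  have fE := (eqaddoP _ (f \o shift x) (cst (f x) + (dfL : _ -> _)) id).2 key.
  by apply/diff_locallyP; rewrite (diff_unique df_cont fE).
move=> e e0.
(* each of the four edges may contribute a quarter of the error *)
have e4 : 0 < e / 4 by rewrite divr_gt0.
have near_pder k : \forall y \near x, `|pder k f x - pder k f y| <= e / 4.
  have /cvgrPdist_le := Ck_on_continuous (Ck_on_pder k cf) Ox; exact.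
have : \forall y \near x, O y /\ forall k, `|pder k f x - pder k f y| <= e / 4.
  apply: filterI; first exact: open_near.
  exact: (@filter_forall _ _
    (fun k => [set y | `|pder k f x - pder k f y| <= e / 4]) (nbhs x) _ near_pder).
move=> /nbhs_ballP[d /= d0 Bd]; apply/nbhs_ballP; exists d => //= h.
rewrite ball_norm sub0r normrN => hd.
(* the corners of the path, relative to x *)
pose P j : 'rV[R]_4 := \row_i (if (i < j)%N then h 0 i else 0).
have PS (k : 'I_4) : P k.+1 = h 0 k *: delta_mx 0 k + P k.
  apply/rowP => i; rewrite !mxE/= ltnS leq_eqVlt.
  have [ik|ik] := eqVneq i k; first by rewrite ik eqxx ltnn mulr1 addr0.
  by rewrite (negbTE ik : (i == k :> nat) = false)/= mulr0 add0r.
have inB (k : 'I_4) (s : R) : `|s| <= `|h 0 k| ->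
    ball x d (s *: delta_mx 0 k + (P k + x)).
  move=> sk; rewrite ball_norm; apply: le_lt_trans hd.
  apply: norm_le_coord => // i; rewrite !mxE/=.
  have [->|ik] := eqVneq i k.
    rewrite ltnn mulr1 add0r opprD addrCA subrr addr0 normrN.
    exact: le_trans sk (coord_le_norm _ _).
  rewrite mulr0 add0r opprD addrCA subrr addr0 normrN.
  by case: ifP => _; rewrite ?normr0//; exact: coord_le_norm.
have step (k : 'I_4) : `|f (P k.+1 + x) - f (P k + x) - h 0 k * pder k f x|
    <= e / 4 * `|h|.
  have [|s sk] := @MVT_line f (P k + x) (delta_mx 0 k) (h 0 k).
    move=> s sk; have [Oy _] := Bd _ (inB k s sk); exact: Ck_on_derivable cf Oy.
  rewrite addrA -PS => ->; rewrite -mulrBr normrM distrC mulrC.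
  have [_ /(_ k) le] := Bd _ (inB k s sk).
  by apply: ler_pM => //; exact: coord_le_norm.
have P0 : P 0%N = 0 by apply/rowP => i; rewrite !mxE.
have P4 : P 4%N = h by apply/rowP => i; rewrite !mxE ltn_ord.
have tele : f (h + x) - f x = \sum_(k < 4) (f (P k.+1 + x) - f (P k + x)).
  by rewrite -(big_mkord xpredT (fun k => f (P k.+1 + x) - f (P k + x)))
     telescope_sumr// P0 P4 add0r.
rewrite opprD addrA tele /df -sumrB.
apply: le_trans (ler_norm_sum _ _ _) _.
apply: le_trans (_ : \sum_(k < 4) e / 4 * `|h| <= _); first exact: ler_sum.
by rewrite sumr_const card_ord; lra.
Qed.

Lemma derive_sum_pder f x v : differentiable f x ->
  'D_v f x = \sum_k v 0 k * pder k f x.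
Proof.
move=> df; rewrite deriveE// {1}(row_sum_delta v) linear_sum; apply: eq_bigr => k _.
by rewrite linearZ /pder deriveE.
Qed.

End Differentiability.

(** * Second order conditions at a minimum *)

Section TraceInequality.
Context {R : realFieldType}.

(** [B] is the sum of a rank one matrix built on its first row and of a matrix
    whose first row and column vanish, the rest of which is the Schur complement
    of the corner entry. *)
Lemma schur_decomposition n (B H : 'I_n.+1 -> 'I_n.+1 -> R) :
  (forall k l, B k l = B l k) -> B ord0 ord0 != 0 ->
  \sum_k \sum_l B k l * H k l =
  (B ord0 ord0)^-1 * (\sum_k \sum_l B ord0 k * B ord0 l * H k l) +
  \sum_k \sum_l (B (lift ord0 k) (lift ord0 l) -
      (B ord0 ord0)^-1 * B ord0 (lift ord0 k) * B ord0 (lift ord0 l)) *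
     H (lift ord0 k) (lift ord0 l).
Proof.
move=> symB b0; set b := B ord0 ord0.
pose D k l := B k l - b^-1 * B ord0 k * B ord0 l.
have D0l l : D ord0 l = 0 by rewrite /D mulVf// mul1r subrr.
have Dl0 k : D k ord0 = 0 by rewrite /D mulrAC mulVf// mul1r symB subrr.
have -> : \sum_k \sum_l B k l * H k l =
    b^-1 * (\sum_k \sum_l B ord0 k * B ord0 l * H k l) +
    \sum_k \sum_l D k l * H k l.
  rewrite mulr_sumr -big_split; apply: eq_bigr => k _ /=.
  rewrite mulr_sumr -big_split; apply: eq_bigr => l _ /=.
  by rewrite /D; ring.
congr (_ + _); rewrite big_ord_recl big1 ?add0r => [|l _]; last first.
  by rewrite D0l mul0r.
by apply: eq_bigr => k _; rewrite big_ord_recl Dl0 mul0r add0r.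
Qed.

(** The rank one part of [schur_decomposition] contributes a value of the
    quadratic form of [H], and the Schur complement is again positive definite:
    induction on [n] amounts to a Cholesky decomposition of [B]. *)
Lemma posdef_psd_trace_ge0 n (B H : 'I_n -> 'I_n -> R) :
  (forall k l, B k l = B l k) ->
  (forall v : 'I_n -> R, (exists k, v k != 0) ->
     0 < \sum_k \sum_l B k l * (v k * v l)) ->
  (forall v : 'I_n -> R, 0 <= \sum_k \sum_l v k * v l * H k l) ->
  0 <= \sum_k \sum_l B k l * H k l.
Proof.
elim: n B H => [|n IH] B H symB posB psdH; first by rewrite big_ord0.
have b0 : 0 < B ord0 ord0.
  have e0 : exists k : 'I_n.+1, (k == ord0)%:R != 0 :> R.
    by exists ord0; rewrite eqxx oner_neq0.
  have := posB _ e0; rewrite big_ord_recl [X in _ + X]big1 => [|k _]; last first.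
    by rewrite big1// => l _; rewrite mul0r mulr0.
  rewrite addr0 big_ord_recl big1 => [|l _]; last by rewrite !mulr0.
  by rewrite eqxx !mulr1 addr0.
rewrite schur_decomposition ?gt_eqF//; apply: addr_ge0.
  by apply: mulr_ge0; [rewrite invr_ge0 ltW|exact: psdH].
apply: IH => [k l|v [k vk]|v].
- by rewrite symB mulrAC.
- pose s := \sum_k v k * B ord0 (lift ord0 k).
  (* extends v so as to kill the rank one part of the form of B *)
  pose w k := if unlift ord0 k is Some j then v j else - s / B ord0 ord0.
  have wS j : w (lift ord0 j) = v j by rewrite /w liftK.
  have w0 : w ord0 = - s / B ord0 ord0 by rewrite /w unlift_none.
  have orth : \sum_k B ord0 k * w k = 0.
    rewrite big_ord_recl w0 mulrC divfK ?gt_eqF//.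
    under eq_bigr do rewrite wS mulrC.
    by rewrite addNr.
  have w_neq0 : exists k, w k != 0 by exists (lift ord0 k); rewrite wS.
  have := posB _ w_neq0; rewrite schur_decomposition ?gt_eqF//.
  under eq_bigr => i _ do under eq_bigr => j _ do rewrite mulrACA.
  under eq_bigr => i _ do rewrite -mulr_sumr orth mulr0.
  rewrite big1// mulr0 add0r => pos.
  by under eq_bigr => i _ do under eq_bigr => j _ do rewrite -(wS i) -(wS j).
- have := psdH (fun k => if unlift ord0 k is Some j then v j else 0).
  rewrite big_ord_recl [X in X + _]big1 ?add0r => [|l _]; last first.
    by rewrite unlift_none !mul0r.
  congr (_ <= _); apply: eq_bigr => k _.
  rewrite big_ord_recl unlift_none mulr0 mul0r add0r.
  by apply: eq_bigr => l _; rewrite !liftK.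
Qed.

End TraceInequality.

Section SecondDerivativeTest.
Context {R : realType}.
Implicit Types (O : set 'rV[R]_4) (f g : 'rV[R]_4 -> R) (x v y : 'rV[R]_4).

Lemma pderM f g x (k : 'I_4) : derivable f x (delta_mx 0 k) ->
  derivable g x (delta_mx 0 k) ->
  pder k (fun y => f y * g y) x = f x * pder k g x + pder k f x * g x.
Proof.
by move=> df dg; apply: etrans (deriveM df dg) _; congr (_ + _); exact: mulrC.
Qed.

Lemma pderZ (a : R) f x (k : 'I_4) : derivable f x (delta_mx 0 k) ->
  pder k (fun y => a * f y) x = a * pder k f x.
Proof.
move=> df; rewrite (pderM (derivable_cst a x (delta_mx 0 k)) df).
have -> : pder k (cst a) x = 0 by rewrite /pder derive_cst.
by rewrite mul0r addr0.
Qed.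

Lemma pder_sum n (F : 'I_n -> 'rV[R]_4 -> R) x (k : 'I_4) :
  (forall i, derivable (F i) x (delta_mx 0 k)) ->
  pder k (fun y => \sum_i F i y) x = \sum_i pder k (F i) x.
Proof.
by move=> dF; rewrite /pder -derive_sum//; congr ('D__ _ _);
   rewrite funeqE => y; rewrite fct_sumE.
Qed.

(** If [g2] were negative, [g1] would be negative just to the right of 0, where
    [g] would then decrease. *)
Lemma local_min_derivatives (g g1 : R -> R) (g2 : R) :
  (\forall s \near (0 : R), is_derive (s : R) 1 g (g1 s)) -> is_derive (0 : R) 1 g1 g2 ->
  (\forall s \near (0 : R), g 0 <= g s) -> g1 0 = 0 /\ 0 <= g2.
Proof.
move=> dg dg1 ming.
have /nbhs_ballP[d /= d0 Bd] : \forall s \near (0 : R),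
  is_derive (s : R) 1 g (g1 s) /\ g 0 <= g s by exact: filterI.
have Bd' (s : R) : `|s| < d -> is_derive (s : R) 1 g (g1 s) /\ g 0 <= g s.
  by move=> sd; apply: Bd; rewrite /ball/= sub0r normrN.
have itvd (s : R) : s \in `]- d, d[ -> `|s| < d.
  by rewrite in_itv/= => ?; rewrite ltr_norml.
have g10 : g1 0 = 0.
  have ab : - d < d by rewrite gtrN.
  have dgi t : t \in `]- d, d[%R -> derivable g t 1 by move=> /itvd /Bd' [[]].
  have ci : (0 : R) \in `](- d), d[%R by rewrite in_itv/= oppr_lt0 d0.
  have mi t : t \in `](- d), d[%R -> g 0 <= g t by move=> /itvd /Bd' [].
  have [_ e] := derive1_at_min (ltW ab) dgi ci mi.
  have [|[_ e'] _] := Bd' 0; first by rewrite normr0.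
  by rewrite -e' e.
split=> //; rewrite leNgt; apply/negP => g2N.
have [dv e] := dg1.
have cv : h^-1 *: (g1 (h%:A + 0) - g1 0) @[h --> 0^'] --> g2 by rewrite -e.
have : \forall h \near 0^', h^-1 *: (g1 (h%:A + 0) - g1 0) < 0.
  exact: (cvgr_lt _ cv).
rewrite /dnbhs/= near_withinE => /nbhs_ballP[d' /= d'0 Bd2].
pose m := Num.min d d' / 2.
have min0 : 0 < Num.min d d' by rewrite lt_min d0.
have m0 : 0 < m by rewrite divr_gt0.
have mlt : m < Num.min d d' by rewrite ltr_pdivrMr// ltr_pMr// ltr1n.
move: mlt; rewrite lt_min => /andP[md md'].
have [||c cI ec] := @MVT _ g g1 0 m m0.
- move=> s; rewrite in_itv/= => /andP[a b].
  by have [] := Bd' s; rewrite ?gtr0_norm// (lt_trans b).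
- apply: derivable_within_continuous => s; rewrite in_itv/= => /andP[a b].
  by have [|[]] := Bd' s; rewrite ?ger0_norm// (le_lt_trans b).
- move: cI; rewrite in_itv/= => /andP[c0 cm].
  have : c^-1 *: (g1 (c%:A + 0) - g1 0) < 0.
    apply: Bd2; last by rewrite gt_eqF.
    by rewrite /ball/= sub0r normrN gtr0_norm// (lt_trans cm).
  rewrite g10 subr0 addr0 [c%:A]mulr1 [_ *: _]/(c^-1 * _) pmulr_rlt0 ?invr_gt0//.
  move=> g1c; have [|_] := Bd' m; first by rewrite gtr0_norm.
  by rewrite -subr_ge0 ec subr0 pmulr_lge0// leNgt g1c.
Qed.

(** [local_min_derivatives] along each line through [x]. *)
Lemma C2_local_min O f x : open O -> O x -> Ck_on 2 O f ->
  (\forall y \near x, f x <= f y) ->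
  (forall k, pder k f x = 0) /\
  (forall v : 'I_4 -> R, 0 <= \sum_k \sum_l v k * v l * pder k (pder l f) x).
Proof.
move=> oO Ox cf minx.
have key v : 'D_v f x = 0 /\
    0 <= \sum_k \sum_l v 0 k * v 0 l * pder k (pder l f) x.
  have cl : (fun s : R => s *: v + x) @ (0 : R) --> x.
    rewrite -{2}[x](add0r x) -(scale0r v).
    by apply: cvgD; [apply: cvgZr_tmp; exact: cvg_id|exact: cvg_cst].
  have nO : \forall s \near (0 : R), O (s *: v + x) by exact: cl (open_near oO Ox).
  have df y : O y -> derivable f y v.
    move=> Oy; apply: diff_derivable.
    exact: C1_differentiable oO Oy (Ck_onS cf).
  pose G y := \sum_l v 0 l * pder l f y.
  have cG : Ck_on 1 O G.
    apply: (Ck_on_sum _ _ oO) => l.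
    exact: (Ck_onM oO (Ck_on_cst 1 _ oO) (Ck_on_pder l cf)).
  have DG : 'D_v G x = \sum_k \sum_l v 0 k * v 0 l * pder k (pder l f) x.
    rewrite derive_sum_pder; last exact: C1_differentiable oO Ox cG.
    apply: eq_bigr => k _; rewrite pder_sum => [|l]; last first.
      exact: derivableM (derivable_cst _ _ _) (Ck_on_derivable (Ck_on_pder l cf) Ox).
    rewrite mulr_sumr; apply: eq_bigr => l _; rewrite pderZ ?mulrA//.
    exact: Ck_on_derivable (Ck_on_pder l cf) Ox.
  rewrite -DG; have e0 : 0 *: v + x = x by rewrite scale0r add0r.
  have [|||] := @local_min_derivatives (fun s => f (s *: v + x))
     (fun s => G (s *: v + x)) ('D_v G x).
  - apply: filterS nO => s Os; rewrite /G -derive_sum_pder; last first.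
      exact: C1_differentiable oO Os (Ck_onS cf).
    by apply: is_derive_line; exact: df.
  - rewrite -{2}e0; apply: is_derive_line; rewrite e0; apply: diff_derivable.
    exact: C1_differentiable oO Ox cG.
  - by rewrite e0; exact: cl minx.
  - rewrite e0 => G0 ?; split=> //.
    by rewrite derive_sum_pder//; exact: C1_differentiable oO Ox (Ck_onS cf).
have key0 k : pder k f x = 0 by have [] := key (delta_mx 0 k).
split=> // v; have [_] := key (\row_k v k).
by under eq_bigr => k _ do under eq_bigr => l _ do rewrite !mxE.
Qed.

End SecondDerivativeTest.

(** * Elliptic operators in divergence form *)

Section EllipticOperator.
Context {R : realType}.
Implicit Types (O : set 'rV[R]_4) (f g : 'rV[R]_4 -> R) (x v y : 'rV[R]_4).
Implicit Types (B : 'I_4 -> 'I_4 -> 'rV[R]_4 -> R) (C : 'rV[R]_4 -> R).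

Record elliptic_on O B C : Prop := EllipticOn {
  elliptic_C1 : forall k l, Ck_on 1 O (B k l) ;
  elliptic_C0 : Ck_on 0 O C ;
  elliptic_sym : forall x, O x -> forall k l, B k l x = B l k x ;
  elliptic_pos : forall x, O x -> forall v : 'I_4 -> R, (exists k, v k != 0) ->
    0 < \sum_k \sum_l B k l x * (v k * v l) }.

Definition elliptic_op B C f x : R :=
  \sum_k pder k (fun y => \sum_l B k l y * pder l f y) x - C x * f x.

Context (O : set 'rV[R]_4) (B : 'I_4 -> 'I_4 -> 'rV[R]_4 -> R)
  (C : 'rV[R]_4 -> R) (oO : open O) (ellBC : elliptic_on O B C).
Local Notation Q := (elliptic_op B C).

Lemma flux_C1 f k : Ck_on 2 O f -> Ck_on 1 O (fun y => \sum_l B k l y * pder l f y).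
Proof.
move=> cf; apply: (Ck_on_sum _ _ oO) => l.
exact: (Ck_onM oO (elliptic_C1 ellBC k l) (Ck_on_pder l cf)).
Qed.

Lemma elliptic_op_continuous f : Ck_on 2 O f -> Ck_on 0 O (Q f).
Proof.
move=> cf; apply: (Ck_onD oO).
  by apply: (Ck_on_sum _ _ oO) => k; apply: Ck_on_pder; exact: flux_C1.
apply: Ck_on_ext (Ck_onM oO (Ck_on_cst 0 (-1) oO)
  (Ck_onM oO (elliptic_C0 ellBC) (Ck_onS (Ck_onS cf)))) => // x _.
by rewrite mulN1r.
Qed.

Lemma elliptic_op_expand f x : Ck_on 2 O f -> O x -> Q f x =
  \sum_k \sum_l B k l x * pder k (pder l f) x +
  \sum_k \sum_l pder k (B k l) x * pder l f x - C x * f x.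
Proof.
move=> cf Ox; rewrite /elliptic_op -big_split; congr (_ - _).
apply: eq_bigr => k _.
have dB l : derivable (B k l) x (delta_mx 0 k).
  exact: Ck_on_derivable (elliptic_C1 ellBC k l) Ox.
have df l : derivable (pder l f) x (delta_mx 0 k).
  exact: Ck_on_derivable (Ck_on_pder l cf) Ox.
rewrite pder_sum => [|l]; last exact: derivableM.
by rewrite -big_split; apply: eq_bigr => l _; rewrite pderM.
Qed.

Lemma pderD_scale f g (a : R) x k : derivable f x (delta_mx 0 k) ->
  derivable g x (delta_mx 0 k) ->
  pder k (fun y => f y + a * g y) x = pder k f x + a * pder k g x.
Proof.
move=> df dg; rewrite -pderZ// /pder.
exact: (deriveD df (derivableM (derivable_cst a _ _) dg)).
Qed.

Lemma elliptic_opD_scale f g (a : R) x : Ck_on 2 O f -> Ck_on 2 O g -> O x ->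
  Q (fun y => f y + a * g y) x = Q f x + a * Q g x.
Proof.
move=> cf cg Ox.
have cag := Ck_onM oO (Ck_on_cst 2 a oO) cg.
rewrite (elliptic_op_expand (Ck_onD oO cf cag) Ox).
rewrite (elliptic_op_expand cf Ox) (elliptic_op_expand cg Ox).
have p1 y k : O y -> pder k (fun y => f y + a * g y) y = pder k f y + a * pder k g y.
  move=> Oy; apply: pderD_scale; first exact: Ck_on_derivable cf Oy.
  exact: Ck_on_derivable cg Oy.
have p2 k l : pder k (pder l (fun y => f y + a * g y)) x =
    pder k (pder l f) x + a * pder k (pder l g) x.
  rewrite -pderD_scale; last 2 first.
  - exact: Ck_on_derivable (Ck_on_pder l cf) Ox.
  - exact: Ck_on_derivable (Ck_on_pder l cg) Ox.
  apply: near_eq_derive; apply: filterS (open_near oO Ox) => y Oy; exact: p1.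
have sum2D (c F G H : 'I_4 -> 'I_4 -> R) :
    (forall k l, H k l = F k l + a * G k l) ->
    \sum_k \sum_l c k l * H k l =
    \sum_k \sum_l c k l * F k l + a * \sum_k \sum_l c k l * G k l.
  move=> HE; rewrite mulr_sumr -big_split; apply: eq_bigr => k _.
  rewrite mulr_sumr -big_split; apply: eq_bigr => l _ /=.
  by rewrite HE mulrDr mulrCA.
have combine (s2 s1 a2 b2 a1 b1 c fx gx : R) :
    s2 = a2 + a * b2 -> s1 = a1 + a * b1 ->
    s2 + s1 - c * (fx + a * gx) = (a2 + a1 - c * fx) + a * (b2 + b1 - c * gx).
  by move=> -> ->; ring.
have e2 := sum2D (fun k l => B k l x) _ _ _ p2.
have e1 := sum2D (fun k l => pder k (B k l) x) _ _ _ (fun k l => p1 x l Ox).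
exact: combine e2 e1.
Qed.

(** At a minimum with value 0 only the second order terms survive, and they are
    the trace of the product of [B] and the Hessian. The value 0
    removes the zeroth order term, whose sign is arbitrary. *)
Lemma elliptic_op_local_min f x : Ck_on 2 O f -> O x -> f x = 0 ->
  (\forall y \near x, f x <= f y) -> 0 <= Q f x.
Proof.
move=> cf Ox fx0 minx; have [df0 hess] := C2_local_min oO Ox cf minx.
rewrite (elliptic_op_expand cf Ox) fx0 mulr0 subr0 [X in _ + X]big1 => [|k _]; last first.
  by rewrite big1// => l _; rewrite df0 mulr0.
rewrite addr0.
exact: posdef_psd_trace_ge0 (elliptic_sym ellBC Ox) (elliptic_pos ellBC Ox) hess.
Qed.

(** The function vanishes to second order where [t] does: the only terms left
    are those with one derivative on each factor [t]. *)
Lemma elliptic_op_square t u y : Ck_on 2 O t -> Ck_on 2 O u -> O y -> t y = 0 ->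
  Q (fun x => t x * (t x * u x)) y =
  2 * u y * \sum_k \sum_l B k l y * (pder k t y * pder l t y).
Proof.
move=> ct cu Oy ty0.
pose G k x := \sum_l B k l x * (pder l t x * u x + pder l (fun x => t x * u x) x).
have ctu := Ck_onM oO ct cu.
have cG k : Ck_on 1 O (G k).
  apply: (Ck_on_sum _ _ oO) => l; apply: (Ck_onM oO (elliptic_C1 ellBC k l)).
  exact: (Ck_onD oO (Ck_onM oO (Ck_on_pder l ct) (Ck_onS cu)) (Ck_on_pder l ctu)).
have dt x k : O x -> derivable t x (delta_mx 0 k).
  by move=> Ox; exact: Ck_on_derivable ct Ox.
have du x k : O x -> derivable u x (delta_mx 0 k).
  by move=> Ox; exact: Ck_on_derivable cu Ox.
have fluxE k : pder k (fun x => \sum_l B k l x *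
    pder l (fun x => t x * (t x * u x)) x) y = pder k t y * G k y.
  transitivity (pder k (fun x => t x * G k x) y).
    apply: near_eq_derive; apply: filterS (open_near oO Oy) => x Ox.
    rewrite /G mulr_sumr; apply: eq_bigr => l _.
    rewrite pderM; last 2 first.
    - exact: dt.
    - exact: Ck_on_derivable ctu Ox.
    by ring.
  rewrite pderM; last 2 first.
  - exact: dt.
  - exact: Ck_on_derivable (cG k) Oy.
  by rewrite ty0 mul0r add0r.
rewrite /elliptic_op ty0 mul0r mulr0 subr0 mulr_sumr; apply: eq_bigr => k _.
rewrite fluxE /G !mulr_sumr; apply: eq_bigr => l _.
rewrite pderM; last 2 first.
- exact: dt.
- exact: du.
rewrite ty0 mul0r add0r -mulrDr -mulr2n -mulr_natl; set b := B k l y.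
by set dk := pder k t y; set dl := pder l t y; ring.
Qed.

End EllipticOperator.

(** * Hopf's strong minimum principle *)

Section HopfPrinciple.
Context {R : realType}.
Implicit Types (O : set 'rV[R]_4) (f g : 'rV[R]_4 -> R) (x c y p q : 'rV[R]_4).

(** The norm of ['rV_4] is the sup norm; the barrier needs Euclidean balls. *)
Definition sqdist c x : R := \sum_k (x 0 k - c 0 k) ^+ 2.

Lemma sqdist_Ck m O c : open O -> Ck_on m O (sqdist c).
Proof.
move=> oO; apply: Ck_on_sum => // k.
have ck := Ck_onD oO (Ck_on_coord m k oO) (Ck_on_cst m (- c 0 k) oO).
exact: (Ck_onM oO ck ck).
Qed.

Lemma pder_sqdist c x k : pder k (sqdist c) x = 2 * (x 0 k - c 0 k).
Proof.
pose d l y : R := y 0 l + - c 0 l.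
have oT : open [set: 'rV[R]_4] by exact: openT.
have cd m l : Ck_on m [set: 'rV[R]_4] (d l).
  exact: Ck_onD oT (Ck_on_coord m l oT) (Ck_on_cst m (- c 0 l) oT).
have dd l : derivable (d l) x (delta_mx 0 k) := Ck_on_derivable (cd 1%N l) I.
have pd l : pder k (d l) x = (l == k)%:R.
  have dx : derivable (id : 'rV[R]_4 -> 'rV[R]_4) x (delta_mx 0 k).
    exact: derivable_id.
  have dl : 'D_(delta_mx 0 k) (fun y : 'rV[R]_4 => y 0 l) x = (l == k)%:R.
    have := derive_mx dx => /(congr1 (fun A : 'rV_4 => A 0 l)).
    by rewrite derive_id !mxE/=.
  have dc := Ck_on_derivable (k := k) (Ck_on_coord 1 l oT) (I : setT x).
  rewrite -dl /pder; apply: etrans (deriveD dc (derivable_cst _ _ _)) _.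
  by rewrite derive_cst addr0.
rewrite (pder_sum (F := fun l y => d l y * d l y)) => [|l]; last exact: derivableM.
rewrite (bigD1 k)//= big1 => [|l lk]; last first.
  by rewrite pderM// pd (negbTE lk) mulr0 mul0r addr0.
by rewrite addr0 pderM// pd eqxx mulr1 mul1r -mulr2n mulr_natl.
Qed.

Lemma sqr_coord_le_sqdist c x k : (x 0 k - c 0 k) ^+ 2 <= sqdist c x.
Proof.
by rewrite /sqdist (bigD1 k)//= lerDl sumr_ge0// => l _; exact: sqr_ge0.
Qed.

Lemma sqdist_ge0 c x : 0 <= sqdist c x.
Proof. by apply: sumr_ge0 => k _; exact: sqr_ge0. Qed.

Lemma sqdist_gt0 c x : x != c -> 0 < sqdist c x.
Proof.
move=> xc; rewrite lt_neqAle sqdist_ge0 andbT; apply: contra_neq xc => e.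
apply/rowP => k; apply/eqP; rewrite -subr_eq0 -sqrf_eq0 eq_le sqr_ge0 andbT.
by rewrite [leRHS]e; exact: sqr_coord_le_sqdist.
Qed.

Lemma sqdist_refl c : sqdist c c = 0.
Proof. by apply: big1 => k _; rewrite subrr expr0n. Qed.

Lemma sqdist_le_norm c x (r : R) : `|x - c| <= r -> sqdist c x <= 4 * r ^+ 2.
Proof.
move=> xr; have -> : 4 * r ^+ 2 = \sum_(k < 4) r ^+ 2.
  by rewrite sumr_const card_ord mulr_natl.
apply: ler_sum => k _; have := coord_le_norm (x - c) k; rewrite !mxE => xk.
rewrite -real_normK ?num_real//; apply: lerXn2r; rewrite ?nnegrE//.
  exact: le_trans xr.
exact: le_trans xk xr.
Qed.

Lemma norm_le_sqdist c x (r : R) : 0 <= r -> sqdist c x <= r ^+ 2 -> `|x - c| <= r.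
Proof.
move=> r0 xr; apply: norm_le_coord => // k; rewrite !mxE.
rewrite -(@ler_pXn2r _ 2)// ?nnegrE// real_normK ?num_real//.
exact: le_trans (sqr_coord_le_sqdist c x k) xr.
Qed.

(** The parallelogram law. *)
Lemma sqdist_midpoint q y x :
  sqdist q x + sqdist y x =
  2 * sqdist (2^-1 *: (q + y)) x + 2^-1 * sqdist q y.
Proof.
rewrite /sqdist !mulr_sumr -!big_split/=; apply: eq_bigr => k _.
by rewrite !mxE; field.
Qed.

Lemma cube_compact p (r : R) : 0 <= r -> compact [set x | `|x - p| <= r].
Proof.
move=> r0; rewrite (_ : [set x | _] =
    [set v : 'rV[R]_4 | forall i, `[p 0 i - r, p 0 i + r]%classic (v ord0 i)]).
  by apply: (rV_compact (A := fun i => `[p 0 i - r, p 0 i + r]%classic)) => i;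
     exact: segment_compact.
apply/seteqP; split => x /=.
  move=> xr i; have := le_trans (coord_le_norm (x - p) i) xr.
  by rewrite !mxE ler_distl in_itv.
move=> xi; apply: norm_le_coord => // k; rewrite !mxE ler_distl.
by have := xi k; rewrite in_itv.
Qed.

Lemma cube_nbhs p (P : set 'rV[R]_4) : nbhs p P ->
  exists2 r : R, 0 < r & [set x | `|x - p| <= r] `<=` P.
Proof.
move=> /nbhs_ballP[r /= r0 rP]; exists (r / 2); first by rewrite divr_gt0.
move=> x /= xr; apply: rP; rewrite ball_norm distrC; apply: le_lt_trans xr _.
by rewrite ltr_pdivrMr// ltr_pMr// ltr1n.
Qed.

Lemma compact_preimage (K : set 'rV[R]_4) f (D : set R) : compact K -> closed D ->
  (forall x, K x -> {for x, continuous f}) -> compact (K `&` f @^-1` D).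
Proof.
move=> cK cD cf; have clK : closed K by apply: compact_closed cK; exact: norm_hausdorff.
apply: subclosed_compact cK _ => [|x []//].
rewrite -openC openE => x nx /=; rewrite /interior.
have [Kx|nKx] := pselect (K x); last first.
  have : nbhs x (~` K) by apply: open_nbhs_nbhs; split=> //; rewrite openC.
  by apply: filterS => w nKw [].
have nDf : (~` D) (f x) by move=> Dfx; apply: nx.
have nb : nbhs (f x) (~` D) by apply: open_nbhs_nbhs; split=> //; rewrite openC.
have nb' : nbhs x (f @^-1` (~` D)) := cf _ Kx _ nb.
by apply: filterS nb' => w nDw [].
Qed.

(** Around a point [q] near [p] with [0 < z q], the largest ball on which [z] is
    positive has a zero [y] of [z] on its boundary, a zero nearest to [q]. The
    ball with diameter [q y] meets the boundary of the former at [y] only, so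
    [y] is the unique zero of [z] in that closed ball. *)
Lemma touching_ball O (z : 'rV[R]_4 -> R) p : open O -> O p ->
  (forall x, O x -> {for x, continuous z}) -> (forall x, O x -> 0 <= z x) ->
  z p = 0 -> ~ (\forall x \near p, z x = 0) ->
  exists c y, [/\ O y, z y = 0, y != c &
    forall x, x != y -> sqdist c x <= sqdist c y -> O x /\ 0 < z x].
Proof.
move=> oO Op cz z0 zp nz.
have [r r0 rO] := cube_nbhs (open_near oO Op).
have [q qp zq] : exists2 q : 'rV[R]_4, `|q - p| < r / 4 & z q != 0.
  apply: contrapT => H; apply: nz; apply/nbhs_ballP.
  exists (r / 4) => /=; first by rewrite divr_gt0.
  move=> q; rewrite ball_norm distrC => qp; apply/eqP/negPn/negP => zq.
  by apply: H; exists q.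
pose K : set 'rV[R]_4 := [set x | `|x - p| <= r]; have cK := @cube_compact p r (ltW r0).
pose Z := K `&` z @^-1` [set t | t = 0].
have cZ : compact Z.
  exact: (@compact_preimage K z _ cK (@closed_eq R 0) (fun x Kx => cz x (rO x Kx))).
have Zp : Z p by split=> //; rewrite /K/= subrr normr0 ltW.
have [|y] := EVT_min_rV (f := sqdist q) (ex_intro _ p Zp) cZ.
  apply: continuous_in_subspaceT => x _.
  exact: Ck_on_continuous (sqdist_Ck 0 q openT) (I : setT x).
rewrite inE => -[Ky zy0] ymin.
have qy : y != q by apply: contra_neq zq => <-.
have yle : sqdist q y <= (r / 2) ^+ 2.
  apply: le_trans (ymin p _) _; first by rewrite inE.
  have pq : `|p - q| <= r / 4 by rewrite distrC ltW.
  by apply: le_trans (sqdist_le_norm pq) _; rewrite le_eqVlt; apply/orP; left;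
     apply/eqP; field.
have inK x : sqdist q x <= sqdist q y -> K x.
  move=> xy; have r2 : 0 <= r / 2 by rewrite divr_ge0// ltW.
  have xq := norm_le_sqdist r2 (le_trans xy yle).
  rewrite /K/= -(subrKA q); apply: le_trans (ler_normD _ _) _.
  apply: le_trans (lerD xq (ltW qp)) _; lra.
exists (2^-1 *: (q + y)), y; split=> //.
- exact: rO.
- apply: contra_neq qy => e; apply/rowP => k.
  by have := congr1 (fun A : 'rV_4 => A 0 k) e; rewrite /= !mxE; lra.
- move=> x xy xle.
  have xq : sqdist q x < sqdist q y.
    have := sqdist_midpoint q y x; have := sqdist_midpoint q y y.
    rewrite sqdist_refl; have := sqdist_gt0 xy; lra.
  have Kx := inK x (ltW xq); have Ox := rO _ Kx; split=> //.
  rewrite lt_neqAle z0// andbT; apply/eqP => zx.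
  have := ymin x; rewrite inE leNgt xq => /(_ _)/negP; apply=> //.
Qed.

(** With [t] positive inside the ball of centre [c] through [y] and negative
    outside, this is [u] times [t + K t^2], which has the sign of [t] near [y].
    The factor [u] makes it comparable to multiples of the solution [u]. *)
Definition barrier (u : 'rV[R]_4 -> R) c y (K : R) x : R :=
  let t := sqdist c y - sqdist c x in t * u x + K * (t * (t * u x)).

(** At [y] the term in [K] contributes [2 u y] times the quadratic form of [B]
    on the gradient of [t], which is nonzero since [y] is not the centre: it
    dominates when [K] is large. *)
Lemma hopf_barrier O B C (u : 'rV[R]_4 -> R) c y : open O -> elliptic_on O B C ->
  Ck_on 2 O u -> 0 < u y -> O y -> y != c ->
  exists K : R, 0 < elliptic_op B C (barrier u c y K) y.
Proof.
move=> oO ell cu uy Oy yc.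
pose t x := sqdist c y + -1 * sqdist c x.
have ct m : Ck_on m O t.
  exact: (Ck_onD oO (Ck_on_cst m _ oO) (Ck_onM oO (Ck_on_cst m _ oO) (sqdist_Ck m c oO))).
have ctu := Ck_onM oO (ct 2%N) cu; have cttu := Ck_onM oO (ct 2%N) ctu.
have ty : t y = 0 by rewrite /t mulN1r subrr.
have pt k : pder k t y = - 2 * (y 0 k - c 0 k).
  have d : derivable (sqdist c) y (delta_mx 0 k).
    exact: Ck_on_derivable (sqdist_Ck 1 c oO) Oy.
  have e := pderD_scale (-1) (derivable_cst (sqdist c y) y (delta_mx 0 k)) d.
  rewrite /t [LHS]e pder_sqdist.
  have -> : pder k (cst (sqdist c y)) y = 0 by rewrite /pder derive_cst.
  by rewrite add0r mulrA mulN1r.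
set alpha := elliptic_op B C (fun x => t x * u x) y.
set beta := elliptic_op B C (fun x => t x * (t x * u x)) y.
have beta_gt0 : 0 < beta.
  rewrite /beta (elliptic_op_square oO ell (ct 2%N) cu Oy ty).
  apply: mulr_gt0; first by rewrite mulr_gt0.
  apply: (elliptic_pos ell Oy (v := fun k => pder k t y)).
  apply: contrapT => H; move/eqP: yc; apply; apply/rowP => k.
  apply/eqP/negPn/negP => yk; apply: H; exists k.
  by rewrite pt mulf_neq0// ?subr_eq0// oppr_eq0.
(* with this constant the value at y is alpha + |alpha| + 1 *)
exists ((`|alpha| + 1) / beta).
have -> : barrier u c y ((`|alpha| + 1) / beta) =
  (fun x => t x * u x + (`|alpha| + 1) / beta * (t x * (t x * u x))).
  by apply/funext => x; rewrite /barrier /t mulN1r.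
rewrite (elliptic_opD_scale oO ell _ ctu cttu Oy) -/alpha -/beta.
rewrite divfK ?gt_eqF//; have := ler_norm (- alpha); rewrite normrN; lra.
Qed.

(** Suppose that [z] does not vanish identically near [p], and let [y] be the
    contact point of [touching_ball]. On a small cube around [y] the barrier
    [hu] satisfies [0 < Q hu]. For [e] small, [z - e hu] is nonnegative on the
    boundary of the cube: where [t >= 0] because [z] has a positive lower bound
    there, where [t < 0] because [hu] is negative. Let [mu] be the minimum of
    [(z - e hu) / u] on the cube; [mu <= 0] as the quotient vanishes at [y]. At
    an interior point of minimum, [f = z - e hu - mu u] has a minimum equal to
    0, so [0 <= Q f], whereas [Q f = Q z - e Q hu - mu Q u < 0]. If the minimum
    is attained on the boundary, then [mu = 0], and it is attained at [y] too. *)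
Lemma strong_minimum_principle O B C (u z : 'rV[R]_4 -> R) p : open O ->
  elliptic_on O B C ->
  Ck_on 2 O u -> (forall x, O x -> 0 < u x) ->
  (forall x, O x -> elliptic_op B C u x <= 0) ->
  Ck_on 2 O z -> (forall x, O x -> 0 <= z x) ->
  (forall x, O x -> elliptic_op B C z x <= 0) ->
  O p -> z p = 0 -> \forall x \near p, z x = 0.
Proof.
move=> oO ell cu u0 Qu cz z0 Qz Op zp; apply: contrapT => nz.
have contz x : O x -> {for x, continuous z} by exact: Ck_on_continuous cz.
have [c [y [Oy zy yc touch]]] := touching_ball oO Op contz z0 zp nz.
have [K Qhu] := hopf_barrier oO ell cu (u0 _ Oy) Oy yc.
pose t x := sqdist c y - sqdist c x.
pose hu := barrier u c y K.
have ctU m U : open U -> Ck_on m U t.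
  move=> oU; have ct' := Ck_onD oU (Ck_on_cst m (sqdist c y) oU)
    (Ck_onM oU (Ck_on_cst m (-1) oU) (sqdist_Ck m c oU)).
  by apply: Ck_on_ext ct' => // x _; rewrite mulN1r.
have ct m : Ck_on m O t by exact: ctU.
have ctu := Ck_onM oO (ct 2%N) cu; have cttu := Ck_onM oO (ct 2%N) ctu.
have chu : Ck_on 2 O hu := Ck_onD oO ctu (Ck_onM oO (Ck_on_cst 2 K oO) cttu).
have ty : t y = 0 by rewrite /t subrr.
have cont_t x : {for x, continuous t}.
  exact: Ck_on_continuous (ctU 0%N _ openT) (I : setT x).
(* the last condition gives the barrier the sign of t *)
have [s s0 sP] : exists2 s : R, 0 < s & [set x | `|x - y| <= s] `<=`
    [set x | O x /\ 0 < elliptic_op B C hu x /\ 0 < 1 + K * t x].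
  apply: cube_nbhs; apply: filterI; first exact: open_near.
  apply: filterI.
    have cQ := Ck_on_continuous (elliptic_op_continuous oO ell chu) Oy.
    exact: (cvgr_gt _ cQ).
  have cK : {for y, continuous (fun x => 1 + K * t x)}.
    have cKt := Ck_onD oO (Ck_on_cst 0 1 oO)
      (Ck_onM oO (Ck_on_cst 0 K oO) (ct 0%N)).
    exact: Ck_on_continuous cKt Oy.
  by apply: (cvgr_gt _ cK); rewrite ty mulr0 addr0.
pose S : set 'rV[R]_4 := [set x | `|x - y| <= s].
have cS : compact S := @cube_compact y s (ltW s0).
have SO x : S x -> O x by move=> /sP[].
have Sy : S y by rewrite /S/= subrr normr0 ltW.
have huE x : hu x = t x * (1 + K * t x) * u x by rewrite /hu /barrier /t; ring.
have no_interior (e mu : R) x : 0 < e -> mu <= 0 -> `|x - y| < s ->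
    z x - e * hu x = mu * u x ->
    (forall w, S w -> mu * u w <= z w - e * hu w) -> False.
  move=> e0 mu0 xs fx fge; have Sx : S x by exact: ltW.
  have Ox := SO _ Sx.
  pose f1 w := z w + - e * hu w; pose f w := f1 w + - mu * u w.
  have cf1 : Ck_on 2 O f1 := Ck_onD oO cz (Ck_onM oO (Ck_on_cst 2 (- e) oO) chu).
  have cf : Ck_on 2 O f := Ck_onD oO cf1 (Ck_onM oO (Ck_on_cst 2 (- mu) oO) cu).
  have fx0 : f x = 0 by rewrite /f /f1 !mulNr fx subrr.
  have minf : \forall w \near x, f x <= f w.
    apply/nbhs_ballP; exists (s - `|x - y|) => /=; first by rewrite subr_gt0.
    move=> w; rewrite ball_norm distrC => wx.
    rewrite fx0 /f /f1 !mulNr subr_ge0; apply: fge.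
    rewrite /S/= -(subrKA x); apply: le_trans (ler_normD _ _) _.
    by rewrite -lerBrDr ltW.
  have := elliptic_op_local_min oO ell cf Ox fx0 minf.
  rewrite (elliptic_opD_scale oO ell _ cf1 cu Ox).
  rewrite (elliptic_opD_scale oO ell _ cz chu Ox).
  have [_ [Qhux _]] := sP _ Sx.
  have a1 := Qz _ Ox; have a2 : - mu * elliptic_op B C u x <= 0.
    by rewrite mulr_ge0_le0 ?oppr_ge0//; exact: Qu.
  have a3 : 0 < e * elliptic_op B C hu x by exact: mulr_gt0.
  by lra.
(* the part of the boundary of the cube in the closed ball, away from y *)
pose E : set 'rV[R]_4 := S `&` ([set x | s <= `|x - y|] `&` [set x | 0 <= t x]).
have cE : compact E.
  apply: compact_closedI cS _; apply: closedI.
    rewrite (_ : [set x | _] = ~` ball y s); last first.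
      by apply/seteqP; split=> x; rewrite /= ball_norm distrC leNgt => /negP.
    by rewrite closedC; exact: ball_open.
  exact: ((continuous_closedP t).1 cont_t _ (@closed_ge R 0)).
have zE x : E x -> 0 < z x.
  move=> [Sx [/= sx tx]]; have [] // := touch x.
    by apply: contraTneq sx => ->; rewrite subrr normr0 -ltNge.
  by rewrite -subr_ge0.
have [e e0 ehu] : exists2 e : R, 0 < e & forall x, E x -> e * hu x <= z x.
  have [E0|/set0P nE0] := eqVneq E set0; first by exists 1 => // x; rewrite E0.
  have [|x0] := EVT_min_rV (f := z) nE0 cE.
    apply: continuous_in_subspaceT => x; rewrite inE => -[Sx _].
    exact: contz (SO _ Sx).
  rewrite inE => Ex0 minz.
  have [|x1] := EVT_max_rV (f := hu) nE0 cE.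
    apply: continuous_in_subspaceT => x; rewrite inE => -[Sx _].
    exact: Ck_on_continuous chu (SO _ Sx).
  rewrite inE => Ex1 maxh.
  have hu1 : 0 <= hu x1.
    have [Sx [_ /= tx]] := Ex1; have [Ox [_ /ltW h1]] := sP _ Sx.
    by rewrite huE mulr_ge0// ?mulr_ge0// ltW// u0.
  exists (z x0 / (hu x1 + 1)); first by rewrite divr_gt0 ?zE// ltr_wpDl.
  move=> x Ex; have Ex' : x \in E by rewrite inE.
  apply: le_trans (minz x Ex'); rewrite mulrAC ler_pdivrMr ?ltr_wpDl//.
  apply: ler_pM => //; [exact/ltW/zE| |by apply: le_trans (maxh x Ex') _; rewrite lerDl].
  have [Sx [_ /= tx]] := Ex; have [Ox [_ /ltW h1]] := sP _ Sx.
  by rewrite huE mulr_ge0// ?mulr_ge0// ltW// u0.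
pose phi x := (z x - e * hu x) / u x.
have phiE x : O x -> z x - e * hu x = phi x * u x.
  by move=> Ox; rewrite divfK// gt_eqF// u0.
have [|x] := EVT_min_rV (f := phi) (ex_intro _ y Sy) cS.
  apply: continuous_in_subspaceT => x; rewrite inE => /SO Ox.
  have cphi : Ck_on 2 O phi.
    have cV : Ck_on 2 O (fun w => (u w)^-1).
      by apply: (Ck_onV oO _ cu) => w Ow; rewrite gt_eqF ?u0.
    have := Ck_onM oO (Ck_onD oO cz (Ck_onM oO (Ck_on_cst 2 (- e) oO) chu)) cV.
    by apply: (Ck_on_ext oO) => w _; rewrite mulNr.
  exact: Ck_on_continuous cphi Ox.
rewrite inE => Sx minphi.
have hphi w : S w -> phi x * u w <= z w - e * hu w.
  move=> Sw; rewrite (phiE _ (SO _ Sw)) ler_wpM2r//; first exact/ltW/u0/SO.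
  by apply: minphi; rewrite inE.
have phiy : phi y = 0 by rewrite /phi zy huE ty !mul0r mulr0 subrr mul0r.
have phix : phi x <= 0 by rewrite -phiy; apply: minphi; rewrite inE.
have [xs|xs] := ltP `|x - y| s.
  exact: (no_interior e (phi x) x e0 phix xs (phiE _ (SO _ Sx)) hphi).
have phix0 : 0 <= phi x.
  have [Ox [_ h1]] := sP _ Sx; apply: divr_ge0; last exact/ltW/u0.
  rewrite subr_ge0; have [tx|tx] := leP 0 (t x); first exact: ehu.
  apply: le_trans (z0 _ Ox); rewrite huE pmulr_rle0// pmulr_lle0 ?u0//.
  by rewrite pmulr_lle0// ltW.
have phi0 : phi x = 0 by apply/eqP; rewrite eq_le phix.
apply: (no_interior e (phi x) y e0 phix); rewrite ?subrr ?normr0//.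
by rewrite phi0 -phiy; exact: phiE.
Qed.

End HopfPrinciple.

(** * The operator L in a chart *)

Section PositiveDefinite.
Context {R : realType}.

Definition posdefmx n (G : 'M[R]_n) : Prop :=
  forall v : 'rV[R]_n, v != 0 -> 0 < (v *m G *m v^T) 0 0.

Lemma posdefmx_det_neq0 n (G : 'M[R]_n) : posdefmx G -> \det G != 0.
Proof.
move=> pG; apply/det0P => -[v v0 vG].
by have := pG v v0; rewrite vG mul0mx mxE ltxx.
Qed.

(** The segment from the identity matrix to [G] consists of positive definite
    matrices, so the determinant, a polynomial along it, keeps the sign it has
    at the identity. *)
Lemma posdefmx_det_gt0 n (G : 'M[R]_n) : posdefmx G -> 0 < \det G.
Proof.
move=> pG; rewrite lt_neqAle eq_sym posdefmx_det_neq0//= leNgt; apply/negP => Gneg.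
pose P : 'M[{poly R}]_n := (1 - 'X) *: 1%:M + 'X *: map_mx polyC G.
have PE t : (\det P).[t] = \det ((1 - t) *: 1%:M + t *: G).
  rewrite -[LHS]/(horner_eval t (\det P)) -det_map_mx; congr (\det _).
  apply/matrixP => i j; rewrite !mxE/= /horner_eval !hornerE.
  by case: (i == j); rewrite ?hornerE.
have [|t /andP[t0 t1]] := @poly_ivt _ (- \det P) 0 1 ler01.
  rewrite !hornerN !PE subrr subr0 !scale0r !scale1r addr0 add0r det1.
  by rewrite lerN10 oppr_ge0 ltW.
rewrite /root hornerN oppr_eq0 PE; apply/negP.
apply: posdefmx_det_neq0 => v v0; rewrite mulmxDr mulmxDl.
rewrite -!scalemxAr -!scalemxAl mulmx1 [X in 0 < X]mxE.
rewrite [X in 0 < X + _]mxE [X in 0 < _ + X]mxE.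
have vv : 0 < (v *m v^T) 0 0.
  have [k vk] : exists k, v 0 k != 0 by apply/rV0Pn.
  rewrite mxE (bigD1 k)//= mxE; apply: ltr_pwDl.
    by rewrite lt_neqAle eq_sym mulf_neq0//= -expr2 sqr_ge0.
  by apply: sumr_ge0 => l _; rewrite mxE -expr2 sqr_ge0.
have := pG v v0; have [->|tn] := eqVneq t 0.
  by rewrite mul0r addr0 subr0 mul1r.
move=> vG; apply: ltr_wpDl; first by rewrite mulr_ge0 ?subr_ge0// ltW.
by rewrite mulr_gt0// lt_neqAle eq_sym tn.
Qed.

Lemma posdefmx_unit n (G : 'M[R]_n) : posdefmx G -> G \in unitmx.
Proof. by move=> /posdefmx_det_neq0; rewrite unitmxE unitfE. Qed.

Lemma posdefmx_inv n (G : 'M[R]_n) : posdefmx G -> G^T = G -> posdefmx (invmx G).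
Proof.
move=> pG sG v v0; have uG := posdefmx_unit pG.
have := pG (v *m invmx G); rewrite mulmxKV// trmx_mul trmx_inv sG mulmxA; apply.
by apply: contra_neq v0 => e; rewrite -(mulmxKV uG v) e mul0mx.
Qed.

End PositiveDefinite.

Section ChartOperator.
Context {R : realType} {M : ptopologicalType} (S : manifold4 R M)
  (g : riemannian_metric S) (a c : M -> R).
Context (ha : smooth S a) (hc : smooth S c) (a_gt0 : forall p, 0 < a p).

Lemma vol_density_gt0 (i : chart S) x : img i x -> 0 < vol_density g i x.
Proof.
by move=> ix; rewrite sqrtr_gt0 posdefmx_det_gt0// => v; exact: gmx_pos.
Qed.

(** [principal_part] and [zeroth_part] are the coefficients of - L multiplied by
    the volume density, which puts the divergence in the form required by
    [elliptic_op]. *)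
Definition principal_part (i : chart S) (k l : 'I_4) (x : 'rV[R]_4) : R :=
  vol_density g i x * a (param i x) * invmx (gmx g i x) l k.

Definition zeroth_part (i : chart S) (x : 'rV[R]_4) : R :=
  vol_density g i x * c (param i x).

Lemma invmx_metric_Ck m (i : chart S) k l :
  Ck_on m (img i) (fun x => invmx (gmx g i x) k l).
Proof.
apply: Ck_on_invmx; first exact: img_open.
  by move=> x ix; apply: posdefmx_unit => v; exact: gmx_pos.
by move=> k' l'; exact: gmx_smooth.
Qed.

Lemma vol_density_Ck m (i : chart S) : Ck_on m (img i) (vol_density g i).
Proof.
apply: Ck_on_sqrt; first exact: img_open.
  by move=> x ix; apply: posdefmx_det_gt0 => v; exact: gmx_pos.
by apply: Ck_on_det => [|k l]; [exact: img_open|exact: gmx_smooth].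
Qed.

Lemma chart_elliptic (i : chart S) :
  elliptic_on (img i) (principal_part i) (zeroth_part i).
Proof.
have oO := img_open (i := i).
split=> [k l||x ix k l|x ix v [k vk]].
- apply: Ck_onM => //; last exact: invmx_metric_Ck.
  by apply: Ck_onM => //; [exact: vol_density_Ck|exact: ha].
- by apply: Ck_onM => //; [exact: vol_density_Ck|exact: hc].
- rewrite /principal_part; congr (_ * _).
  by rewrite -{1}(gmx_sym g ix) -trmx_inv mxE.
- pose w : 'rV[R]_4 := \row_k v k.
  have w0 : w != 0 by apply/rV0Pn; exists k; rewrite mxE.
  have pG : posdefmx (gmx g i x) by move=> z; exact: gmx_pos.
  have := posdefmx_inv pG (gmx_sym g ix) w0.
  suff -> : \sum_k \sum_l principal_part i k l x * (v k * v l) =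
      vol_density g i x * a (param i x) * (w *m invmx (gmx g i x) *m w^T) 0 0.
    by move=> q; rewrite mulr_gt0// mulr_gt0// vol_density_gt0.
  rewrite mxE mulr_sumr; apply: eq_bigr => k' _.
  rewrite !mxE mulr_suml mulr_sumr; apply: eq_bigr => l _.
  by rewrite /principal_part !mxE; ring.
Qed.

Lemma elliptic_op_Lop (i : chart S) (v : M -> R) x : img i x ->
  elliptic_op (principal_part i) (zeroth_part i) (v \o param i) x =
  - vol_density g i x * Lop g a c v i x.
Proof.
move=> ix; rewrite /Lop /divergence /elliptic_op mulrDr mulrNN mulVKf; last first.
  by rewrite gt_eqF// vol_density_gt0.
rewrite /zeroth_part mulNr mulrA; congr (_ - _); apply: eq_bigr => k _.
congr (pder k _ x); apply/funext => y.
rewrite !mxE mulrA mulr_sumr; apply: eq_bigr => l _.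
by rewrite !mxE /principal_part; ring.
Qed.

Lemma Ck_chart_continuous m (u : M -> R) : Ck S m u -> continuous u.
Proof.
move=> cu p; pose i := chart_at S p; have ip := dom_chart_at S p.
have im : img i (coords i p) by exists p.
have cv : {for p, continuous ((u \o param i) \o coords i)}.
  apply: continuous_comp; first exact: coords_cont.
  exact: Ck_on_continuous (cu i) im.
apply: near_eq_continuous cv.
have : \forall q \near p, dom i q by apply: open_nbhs_nbhs; split=> //; exact: dom_open.
by apply: filterS => q iq /=; rewrite coordsK.
Qed.

(** [u - m v] has a minimum equal to 0 at [p], where [elliptic_op_local_min]
    applies. *)
Lemma Lop_at_contact (u v : M -> R) (m : R) p : Ck S 2 u -> Ck S 2 v ->
  (forall q, m * v q <= u q) -> u p = m * v p ->
  forall i, dom i p ->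
  Lop g a c u i (coords i p) <= m * Lop g a c v i (coords i p).
Proof.
move=> cu cv mvu uvp i ip; set x := coords i p.
have ix : img i x by exists p.
have oO := img_open (i := i).
pose f y := (u \o param i) y + - m * (v \o param i) y.
have cf : Ck_on 2 (img i) f.
  exact: (Ck_onD oO (cu i) (Ck_onM oO (Ck_on_cst 2 (- m) oO) (cv i))).
have fx : f x = 0 by rewrite /f/= /x coordsK// uvp mulNr subrr.
have fmin : \forall y \near x, f x <= f y.
  by apply: filterS (open_near oO ix) => y _; rewrite fx /f/= mulNr subr_ge0.
have := elliptic_op_local_min oO (chart_elliptic i) cf ix fx fmin.
rewrite (elliptic_opD_scale oO (chart_elliptic i) (- m) (cu i) (cv i) ix).
rewrite !elliptic_op_Lop// => h.
rewrite -subr_ge0 -(pmulr_rge0 _ (vol_density_gt0 ix)).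
by apply: le_trans h _; rewrite le_eqVlt; apply/orP; left; apply/eqP; ring.
Qed.

(** The contact set is closed by continuity and open by the strong minimum
    principle, applied in charts to [u - m v] with the supersolution [v]. *)
Lemma contact_everywhere (u v : M -> R) (m : R) p : connected [set: M] ->
  Ck S 2 u -> Ck S 2 v -> (forall q, 0 < v q) ->
  (forall i q, dom i q -> 0 <= Lop g a c v i (coords i q)) ->
  (forall i q, dom i q ->
    m * Lop g a c v i (coords i q) <= Lop g a c u i (coords i q)) ->
  (forall q, m * v q <= u q) -> u p = m * v p ->
  forall q, u q = m * v q.
Proof.
move=> conM cu cv v0 Lv Lu mvu uvp.
pose d q := u q - m * v q; pose A := [set q | d q = 0].
suff AT : A = setT.
  by move=> q; apply/eqP; rewrite -subr_eq0; apply/eqP; have : A q by rewrite AT.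
have cd : continuous d.
  move=> q; have cuq : u r @[r --> q] --> u q by exact: Ck_chart_continuous cu q.
  have cvq : v r @[r --> q] --> v q by exact: Ck_chart_continuous cv q.
  have cmv : m * v r @[r --> q] --> m * v q by apply: cvgM cvq; exact: cvg_cst.
  exact: cvgB cuq cmv.
apply: conM; first by exists p; rewrite /A/= /d uvp subrr.
- exists A; last by rewrite setTI.
  rewrite openE => q Aq; rewrite /interior; pose i := chart_at S q.
  have iq : dom i q := dom_chart_at S q.
  have oO := img_open (i := i).
  have ix : img i (coords i q) by exists q.
  pose z y := (u \o param i) y + - m * (v \o param i) y.
  have zE y : z y = d (param i y) by rewrite /z /d mulNr.
  have cz : Ck_on 2 (img i) z.
    exact: (Ck_onD oO (cu i) (Ck_onM oO (Ck_on_cst 2 (- m) oO) (cv i))).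
  have img_dom y : img i y -> exists2 w, dom i w & y = coords i w.
    by move=> [w iw <-]; exists w.
  have Qv y : img i y -> elliptic_op (principal_part i) (zeroth_part i) (v \o param i) y <= 0.
    move=> iy; rewrite elliptic_op_Lop//; have [w iw yw] := img_dom _ iy.
    by rewrite mulNr oppr_le0 mulr_ge0// ?yw ?Lv// ltW// -yw vol_density_gt0.
  have Qz y : img i y -> elliptic_op (principal_part i) (zeroth_part i) z y <= 0.
    move=> iy; rewrite (elliptic_opD_scale oO (chart_elliptic i) _ (cu i) (cv i) iy).
    rewrite !elliptic_op_Lop//; have [w iw yw] := img_dom _ iy.
    have -> (x1 x2 x3 : R) : - x1 * x2 + - m * (- x1 * x3) = - (x1 * (x2 - m * x3)).
      by ring.
    rewrite oppr_le0 mulr_ge0//; first by rewrite ltW// vol_density_gt0.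
    by rewrite subr_ge0 yw Lu.
  have z0 y : img i y -> 0 <= z y by rewrite zE subr_ge0.
  have zq : z (coords i q) = 0 by rewrite zE coordsK.
  have zn := strong_minimum_principle oO (chart_elliptic i) (cv i)
    (fun x _ => v0 (param i x)) Qv cz z0 Qz ix zq.
  have zn' : \forall r \near q, z (coords i r) = 0 := coords_cont iq zn.
  have di : \forall r \near q, dom i r.
    by apply: open_nbhs_nbhs; split=> //; exact: dom_open.
  by apply: filterS2 di zn' => r ir; rewrite zE coordsK.
- exists A; last by rewrite setTI.
  exact: ((continuous_closedP d).1 cd _ (@closed_eq R 0)).
Qed.

End ChartOperator.

(** * Nonnegativity of Dhat *)

Section IntegralBounds.
Local Open Scope ereal_scope.
Context {d : measure_display} {T : measurableType d} {R : realType}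
  (mu : {measure set T -> \bar R}).

Lemma integral_bounds (f : T -> R) (b B : R) : measurable_fun setT f ->
  (forall x, 0 <= b <= f x)%R -> (forall x, f x <= B)%R ->
  b%:E * mu setT <= \int[mu]_x (f x)%:E <= B%:E * mu setT.
Proof.
move=> mf bf fB.
have b0 (x : T) : (0 <= b)%R by have /andP[] := bf x.
have f0 (x : T) : (0 <= f x)%R by have /andP[? ?] := bf x; exact: le_trans (b0 x) _.
have /measurable_EFinP mfE := mf.
apply/andP; split; rewrite -integral_cst//; apply: ge0_le_integral => //.
- by move=> x _; rewrite lee_fin; exact: b0.
- by move=> x _; rewrite lee_fin; have /andP[] := bf x.
- by move=> x _; rewrite lee_fin.
- by move=> x _; rewrite lee_fin.
Qed.

End IntegralBounds.

Section BorelMeasurability.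
Context {R : realType} {M : ptopologicalType}.

Lemma continuous_on_open_measurable (D : set M) (f : M -> R) : open D ->
  (forall p, D p -> {for p, continuous f}) ->
  measurable_fun (D : set (borel M)) (f : borel M -> R).
Proof.
move=> oD cf; apply: (measurability _ (measurable_realfun.RGenOpens.measurableE R)).
move=> _ [_ [a [b ->] <-]]; apply: sub_sigma_algebra.
rewrite openE => p [Dp fp]; rewrite /interior; apply: filterI.
  exact: open_nbhs_nbhs.
by apply: (cf p Dp); apply: open_nbhs_nbhs; split.
Qed.

Lemma continuous_borel_measurable (f : M -> R) : continuous f ->
  measurable_fun setT (f : borel M -> R).
Proof.
by move=> cf; apply: continuous_on_open_measurable => [|p _];
   [exact: openT|exact: cf].
Qed.

Lemma continuous_pos_bounds (f : M -> R) : compact [set: M] -> continuous f ->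
  (forall p, 0 < f p) ->
  exists b B : R, [/\ 0 < b, (forall p, b <= f p) & forall p, f p <= B].
Proof.
move=> cM cf f0; have ne : [set: M] !=set0 by exists point.
have cfT : {within [set: M], continuous f} by exact: continuous_subspaceT.
have [p _ pmin] := compact_EVT_min ne cM cfT.
have [q _ qmax] := compact_EVT_max ne cM cfT.
by exists (f p), (f q); split=> // r; [apply: pmin|apply: qmax]; rewrite inE.
Qed.

Lemma continuous_min (f : M -> R) : compact [set: M] -> continuous f ->
  exists p, forall q, f p <= f q.
Proof.
move=> cM cf; have ne : [set: M] !=set0 by exists point.
have cfT : {within [set: M], continuous f} by exact: continuous_subspaceT.
have [p _ pmin] := compact_EVT_min ne cM cfT.
by exists p => q; apply: pmin; rewrite inE.
Qed.

End BorelMeasurability.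

Section GradientField.
Context {R : realType} {M : ptopologicalType} (S : manifold4 R M)
  (g : riemannian_metric S).

Lemma overlap_open (i j : chart S) : open (coords i @` (dom i `&` dom j)).
Proof.
rewrite openE => _ [p [ip jp] <-]; rewrite /interior.
have ix : img i (coords i p) by exists p.
have nj : \forall z \near coords i p, dom j (param i z).
  apply: (param_cont ix); apply: open_nbhs_nbhs; rewrite coordsK//.
  by split=> //; exact: dom_open.
apply: filterS2 (open_near (img_open (i := i)) ix) nj => _ [q iq <-].
by rewrite coordsK// => jq; exists q.
Qed.

Lemma transition_differentiable (i j : chart S) p : dom i p -> dom j p ->
  differentiable (transition i j) (coords i p).
Proof.
move=> ip jp.
have -> : transition i j =
    \sum_(k < 4) (fun x => coords j (param i x) 0 k *: delta_mx 0 k).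
  apply/funext => x; rewrite fct_sumE [LHS](row_sum_delta (coords j (param i x))).
  by [].
apply: differentiable_sum => k; apply: differentiableZl.
have Ux : (coords i @` (dom i `&` dom j)) (coords i p) by exists p.
exact: (C1_differentiable (@overlap_open i j) Ux (@transition_smooth _ _ S i j k 1%N)).
Qed.

(** The chain rule: differentials of functions transform by the Jacobian. *)
Lemma pder_change_chart (u : M -> R) (i j : chart S) p : Ck S 1 u ->
  dom i p -> dom j p ->
  \row_k pder k (u \o param i) (coords i p) =
  (\row_k pder k (u \o param j) (coords j p)) *m
    ('J (transition i j) (coords i p))^T.
Proof.
move=> cu ip jp; set x := coords i p.
have dT := transition_differentiable ip jp.
have Tx : transition i j x = coords j p by rewrite /transition/= /x coordsK.
have duj : differentiable (u \o param j) (transition i j x).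
  rewrite Tx; apply: C1_differentiable (img_open (i := j)) _ (cu j).
  by exists p.
apply/rowP => k; rewrite !mxE.
have -> : pder k (u \o param i) x =
    pder k ((u \o param j) \o transition i j) x.
  apply: near_eq_derive.
  have Ux : (coords i @` (dom i `&` dom j)) x by exists p.
  apply: filterS (open_near (@overlap_open i j) Ux) => _ [q [iq jq] <-].
  by rewrite /transition/= !coordsK.
have -> : pder k ((u \o param j) \o transition i j) x =
    'D_(delta_mx 0 k *m 'J (transition i j) x) (u \o param j) (transition i j x).
  rewrite /pder (deriveE _ (differentiable_comp dT duj)) (diff_comp dT duj) /=.
  by rewrite (deriveE _ duj) -(deriveEjacobian _ dT) (deriveE _ dT).
rewrite (derive_sum_pder _ duj) -rowE Tx; apply: eq_bigr => l _.
by rewrite !mxE mulrC.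
Qed.

(** With D the differential and J the Jacobian of the transition map,
    D_i = D_j J^T and G_i = J G_j J^T, hence D_i G_i^-1 J = D_j G_j^-1. *)
Lemma grad_vector_field (u : M -> R) : Ck S 1 u -> vector_field (grad g u).
Proof.
move=> cu i j p ip jp; rewrite /grad (pder_change_chart cu ip jp).
set x := coords i p; set J := 'J (transition i j) x.
set Gj := gmx g j (coords j p); set D := \row_k _.
have ix : img i x by exists p.
have jy : img j (coords j p) by exists p.
have Gi : gmx g i x = J *m Gj *m J^T := gmx_compat g ip jp.
have uGi : gmx g i x \in unitmx by apply: posdefmx_unit => v; exact: gmx_pos.
have uGj : Gj \in unitmx by apply: posdefmx_unit => v; exact: gmx_pos.
have uJ : J^T \in unitmx by move: uGi; rewrite Gi unitmx_mul => /andP[].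
suff e : J^T *m invmx (gmx g i x) *m J *m Gj = 1%:M.
  by rewrite -[invmx Gj]mul1mx -e mulmxK// !mulmxA.
apply: (can_inj (mulmxK uJ)).
by rewrite mul1mx -!mulmxA (mulmxA J) -Gi mulVmx// mulmx1.
Qed.

Lemma grad_component_continuous (u : M -> R) (i : chart S) (k : 'I_4) p :
  Ck S 1 u -> dom i p ->
  {for p, continuous (fun q => grad g u i (coords i q) 0 k)}.
Proof.
move=> cu ip; have oO := img_open (i := i).
have ix : img i (coords i p) by exists p.
have cg : Ck_on 0 (img i) (fun x => grad g u i x 0 k).
  have c1 : Ck_on 0 (img i) (fun x =>
      \sum_l pder l (u \o param i) x * invmx (gmx g i x) l k).
    apply: Ck_on_sum => // l; apply: (Ck_onM oO); last exact: invmx_metric_Ck.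
    exact: Ck_on_pder (cu i).
  by apply: Ck_on_ext c1 => // x _; rewrite !mxE; apply: eq_bigr => l _; rewrite mxE.
apply: (@continuous_comp _ _ _ (coords i) (fun x => grad g u i x 0 k)).
  exact: coords_cont.
exact: Ck_on_continuous cg ix.
Qed.

(** A smooth function is the limit of the constant sequence equal to it. *)
Lemma smooth_in_H1 (mu : {measure set (borel M) -> \bar R}) (u : M -> R) :
  smooth S u -> in_H1 g mu u (grad g u).
Proof.
move=> su; have cu m : Ck S m u by move=> i; exact: su.
split.
- exact: continuous_borel_measurable (Ck_chart_continuous (cu 0%N)).
- exact: grad_vector_field.
- move=> i k; apply: continuous_on_open_measurable => [|p ip].
    exact: dom_open.
  exact: grad_component_continuous.
- exists (fun=> u); split=> //.
  have z p : (u p - u p) ^+ 2 + normsq g (fun i x => grad g u i x - grad g u i x) p = 0.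
    by rewrite subrr expr0n add0r /normsq subrr !mul0mx mxE.
  under eq_fun => m do under eq_integral => p _ do rewrite z.
  by rewrite integral0; exact: cvg_cst.
Qed.

End GradientField.

Section Nonnegativity.
Context {R : realType} {M : ptopologicalType} (S : manifold4 R M)
  (g : riemannian_metric S) (mu : {measure set (borel M) -> \bar R})
  (a c : M -> R).
Context (cM : compact [set: M]) (lambda1_ge0 : (0 <= lambda1 g mu a c)%E).

(** [u] competes in the infimum defining [lambda1], and its L^2 norm is finite and
    nonzero because [u] lies between positive constants. *)
Lemma energy_ge0 (u : M -> R) : smooth S u -> (forall p, 0 < u p) ->
  (0 < mu setT < +oo)%E -> 0 <= energy g mu a c u (grad g u).
Proof.
move=> su u0 /andP[mu0 muoo].
have cu : continuous u := Ck_chart_continuous (fun i => su i 0%N).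
have cu2 : continuous (fun p => u p ^+ 2).
  by move=> p; exact: (cvgM (cu p) (cu p)).
have [b [B [b0 bu uB]]] := continuous_pos_bounds cM cu2 (fun p => exprn_gt0 2 (u0 p)).
have bu' p : 0 <= b <= u p ^+ 2 by rewrite ltW//=.
have /andP[lo hi] := integral_bounds mu (continuous_borel_measurable cu2) bu' uB.
have muE : mu setT = (fine (mu setT))%:E.
  by rewrite fineK// ge0_fin_numE// ltW.
have intE : (\int[mu]_p (u p ^+ 2)%:E = (\int[mu]_p (u p ^+ 2))%:E)%E.
  rewrite /Rintegral fineK// ge0_fin_numE; last first.
    by apply: integral_ge0 => p _; rewrite lee_fin sqr_ge0.
  by apply: le_lt_trans hi _; rewrite muE -EFinM ltry.
have int_gt0 : 0 < \int[mu]_p (u p ^+ 2).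
  rewrite -lte_fin -intE; apply: lt_le_trans lo.
  by rewrite mule_gt0// lte_fin.
have : (0 <= (energy g mu a c u (grad g u) / \int[mu]_p (u p ^+ 2))%:E)%E.
  apply: le_trans lambda1_ge0 _; apply: ereal_inf_lbound.
  exists u, (grad g u); split=> //; first exact: smooth_in_H1.
  move=> [A [mA muA0 sub]].
  have AT : A = setT.
    by apply/seteqP; split=> // p _; apply: sub => /= up; have := u0 p; rewrite up ltxx.
  by move: mu0; rewrite -AT muA0 ltxx.
by rewrite lee_fin pmulr_lge0// invr_gt0.
Qed.

(** If the real integral of [u^-4] is 0, which includes the case where that
    integral is infinite, the first factor vanishes. Otherwise the volume is
    positive and finite, as [u^-4] lies between positive constants. *)
Lemma Dfun_ge0 (u : M -> R) : smooth S u -> (forall p, 0 < u p) ->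
  0 <= Dfun g mu a c u.
Proof.
move=> su u0; rewrite /Dfun.
have [I0|I0] := leP (\int[mu]_p (u p ^- 4)) 0.
  by rewrite ler0_sqrtr// mul0r.
apply: mulr_ge0; first exact: sqrtr_ge0.
have cu : continuous u := Ck_chart_continuous (fun i => su i 0%N).
have cu4 : continuous (fun p => u p ^- 4).
  move=> p; apply: cvgV; first by rewrite gt_eqF// exprn_gt0.
  exact: (cvgM (cu p) (cvgM (cu p) (cvgM (cu p) (cu p)))).
have u40 p : 0 < u p ^- 4 by rewrite invr_gt0 exprn_gt0.
have [b [B [b0 bu uB]]] := continuous_pos_bounds cM cu4 u40.
have bu' p : 0 <= b <= u p ^- 4 by rewrite ltW//=.
have /andP[lo hi] := integral_bounds mu (continuous_borel_measurable cu4) bu' uB.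
apply: energy_ge0 => //; apply/andP; split.
  rewrite lt_neqAle measure_ge0 andbT eq_sym; apply/eqP => mu0.
  move: hi; rewrite mu0 mule0 => hi; move: I0.
  rewrite /Rintegral; suff -> : (\int[mu]_p (u p ^- 4)%:E = 0)%E by rewrite ltxx.
  apply/eqP; rewrite eq_le hi integral_ge0// => p _.
  by rewrite lee_fin ltW.
rewrite ltey; apply/eqP => muoo.
move: lo I0; rewrite muoo gt0_muley ?lte_fin// leye_eq => /eqP.
by rewrite /Rintegral => -> /=; rewrite ltxx.
Qed.

Lemma Dhat_ge0 : (0 <= Dhat g mu a c)%E.
Proof.
apply: le_ereal_inf_tmp => _ [u [su u0 ->]].
by rewrite lee_fin Dfun_ge0.
Qed.

End Nonnegativity.

(** * Comparison of two solutions *)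

(** [m] is the minimum of [u / v]. *)
Lemma min_ratio (R : realType) (M : ptopologicalType) (S : manifold4 R M)
    (u v : M -> R) : compact [set: M] -> Ck S 2 u -> Ck S 2 v ->
  (forall p, 0 < u p) -> (forall p, 0 < v p) ->
  exists m p, [/\ 0 < m, forall q, m * v q <= u q & u p = m * v p].
Proof.
move=> cM cu cv u0 v0.
have cr : continuous (fun p => u p / v p).
  move=> p; have cup : u q @[q --> p] --> u p by exact: Ck_chart_continuous cu p.
  have cvp : v q @[q --> p] --> v p by exact: Ck_chart_continuous cv p.
  by apply: (cvgM cup); apply: cvgV cvp; rewrite gt_eqF.
have [p pmin] := continuous_min cM cr.
exists (u p / v p), p; split; first by rewrite divr_gt0.
  by move=> q; rewrite -ler_pdivlMr.
by rewrite divfK// gt_eqF.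
Qed.

(** At a contact point, [Lop_at_contact] reads
    k1 (m v)^-5 <= m k2 v^-5. *)
Lemma contact_inequality (R : realType) (M : ptopologicalType) (S : manifold4 R M)
    (g : riemannian_metric S) (a c u v : M -> R) (k1 k2 m : R) (p : M) :
  smooth S a -> smooth S c -> (forall q, 0 < a q) ->
  Ck S 2 u -> Ck S 2 v -> 0 < m -> (forall q, 0 < v q) ->
  (forall q, m * v q <= u q) -> u p = m * v p ->
  (forall i q, dom i q -> Lop g a c u i (coords i q) = k1 * u q ^- 5) ->
  (forall i q, dom i q -> Lop g a c v i (coords i q) = k2 * v q ^- 5) ->
  k1 <= m ^+ 6 * k2.
Proof.
move=> ha hc a0 cu cv m0 v0 mvu uvp Lu Lv.
have ip := dom_chart_at S p.
have := Lop_at_contact g ha hc a0 cu cv mvu uvp ip.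
rewrite Lu// Lv// uvp exprMn invfM => h.
have vp5 : 0 < v p ^- 5 by rewrite invr_gt0 exprn_gt0.
move: h; rewrite !mulrA ler_pM2r// ler_pdivrMr ?exprn_gt0// => h.
by apply: le_trans h _; rewrite [leLHS]mulrAC -exprS.
Qed.

Theorem theorem4p8 (R : realType) (M : ptopologicalType) (S : manifold4 R M)
    (g0 : riemannian_metric S) (dV : {measure set (borel M) -> \bar R})
    (hcompact : compact [set: M]) (hconnected : connected [set: M])
    (hdV : is_volume_measure g0 dV)
    (hweyl : weyl_nowhere_zero g0)
    (a c : M -> R) (ha : smooth S a) (hc : smooth S c)
    (ha_pos : forall p, 0 < a p)
    (hlambda1 : (0 <= lambda1 g0 dV a c)%E)
    (u1 u2 : M -> R) (hu1 : Ck S 2 u1) (hu2 : Ck S 2 u2)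
    (hu1_pos : forall p, 0 < u1 p) (hu2_pos : forall p, 0 < u2 p)
    (hsol1 : is_solution g0 dV a c u1) (hsol2 : is_solution g0 dV a c u2) :
  exists beta : R, 0 < beta /\ forall p, u1 p = beta * u2 p.
Proof.
pose k (u : M -> R) := fine (Dhat g0 dV a c) * (\int[dV]_q (u q ^- 4)) `^ (- (3 / 2)).
have k_ge0 u : 0 <= k u.
  by rewrite mulr_ge0 ?powR_ge0// fine_ge0// Dhat_ge0.
have [m [p [m0 mu21 u12p]]] := min_ratio hcompact hu1 hu2 hu1_pos hu2_pos.
have [m' [p' [m'0 mu12 u21p]]] := min_ratio hcompact hu2 hu1 hu2_pos hu1_pos.
have k12 : k u1 <= m ^+ 6 * k u2.
  exact: (contact_inequality ha hc ha_pos hu1 hu2 m0 hu2_pos mu21 u12p hsol1 hsol2).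
have k21 : k u2 <= m' ^+ 6 * k u1.
  exact: (contact_inequality ha hc ha_pos hu2 hu1 m'0 hu1_pos mu12 u21p hsol2 hsol1).
exists m; split=> // q; have [k1_gt0|k1_le0] := ltP 0 (k u1).
  have mm' : 1 <= m * m'.
    have : 1 * k u1 <= (m * m') ^+ 6 * k u1.
      rewrite mul1r exprMn -mulrA; apply: le_trans k12 _.
      by rewrite ler_pM2l// exprn_gt0.
    rewrite ler_pM2r// => h; rewrite -(@ler_pXn2r _ 6)// ?nnegrE ?expr1n//.
    by rewrite mulr_ge0// ltW.
  apply/eqP; rewrite eq_le mu21 andbT.
  apply: le_trans (_ : m * m' * u1 q <= _); first by rewrite ler_peMl// ltW.
  by rewrite -mulrA ler_pM2l.
have k1 : k u1 = 0 by apply/eqP; rewrite eq_le k1_le0 k_ge0.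
have k2 : k u2 = 0.
  by apply/eqP; rewrite eq_le k_ge0 andbT; move: k21; rewrite k1 mulr0.
have L1 i r : dom i r -> Lop g0 a c u1 i (coords i r) = 0.
  by move=> ir; rewrite hsol1// -/(k u1) k1 mul0r.
have L2 i r : dom i r -> Lop g0 a c u2 i (coords i r) = 0.
  by move=> ir; rewrite hsol2// -/(k u2) k2 mul0r.
have L2_ge0 i r : dom i r -> 0 <= Lop g0 a c u2 i (coords i r).
  by move=> ir; rewrite L2.
have L12 i r : dom i r ->
    m * Lop g0 a c u2 i (coords i r) <= Lop g0 a c u1 i (coords i r).
  by move=> ir; rewrite L2// L1// mulr0.
exact: (contact_everywhere ha hc ha_pos hconnected hu1 hu2 hu2_pos L2_ge0 L12
  mu21 u12p).
Qed.
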